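(* Let $M=\prod_{\sigma\in S}M_\sigma$ be a connected real analytic submanifold of $K_S^m$ such that, for each $\sigma\in S$, $M_\sigma$ is not contained in any affine $K$-hyperplane in $K_\sigma^m$ and $\dim(M_\sigma)\ge 2$. Then there exist uncountably many totally irrational singular vectors $\mathbf x$ in $M$ with $\hat\omega(\mathbf x)=\infty$.
   Context: $K$ is a totally real number field of degree $d$ over $\mathbb Q$ with ring of integers $\mathcal O_K$; $S$ is the set of its $d$ archimedean places, identified with the embeddings $\sigma:K\to\mathbb R$. For $\sigma\in S$, $K_\sigma\cong\mathbb R$ is the completion of $\sigma(K)$, and $K_S=\prod_{\sigma\in S}K_\sigma$. $K$ is embedded diagonally in $K_S$ by $\alpha\mapsto(\sigma(\alpha))_{\sigma\in S}$ and identified with its image; similarly $K^m\subset K_S^m\simeq\prod_{\sigma}K_\sigma^m$; write $\mathbf x=(\mathbf x^\sigma)_{\sigma\in S}$ with $\mathbf x^\sigma\in K_\sigma^m$, and $\mathbf q^\sigma=(\sigma(q_1),\dots,\sigma(q_m))$ for $\mathbf q\in\mathcal O_K^m$. For $x=(x^\sigma)\in K_S$, $\|x\|=\max_\sigma|x^\sigma|$; for $\mathbf x=(x_1,\dots,x_m)\in K_S^m$, $\|\mathbf x\|=\max_j\|x_j\|$. For $\mathbf q\in\mathcal O_K^m$, $\mathbf q\cdot\mathbf x=\sum_j q_jx_j\in K_S$. A submanifold of $K_S^m$ means a product $M=\prod_{\sigma\in S}M_\sigma$ of submanifolds $M_\sigma$ of $K_\sigma^m\cong\mathbb R^m$; it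 is real analytic if every $M_\sigma$ is a real analytic submanifold. An affine $K$-hyperplane in $K_\sigma^m$ is an $(m-1)$-dimensional affine subspace that is the zero set in $K_\sigma^m$ of an affine (degree one) polynomial with coefficients in $\sigma(K)$. Singular: $\mathbf x\in K_S^m$ is singular if for every $c>0$, for all sufficiently large $Q>0$ there exist $\mathbf 0\ne\mathbf q\in\mathcal O_K^m$ and $q_0\in\mathcal O_K$ with $\|\mathbf q\cdot\mathbf x+q_0\|<c/Q^m$ and $\|\mathbf q\|\le Q$. Totally irrational: $\mathbf x\in K_S^m$ is totally irrational if for any $\mathbf 0\ne\mathbf q\in\mathcal O_K^m$ and $q_0\in\mathcal O_K$ there is some $\sigma\in S$ with $\mathbf q^\sigma\cdot\mathbf x^\sigma+\sigma(q_0)\ne 0$. Uniform exponent: $\hat\omega(\mathbf x)$ is the supremum of all $v$ such that for all large enough $Q>0$ the system $\|\mathbf q\cdot\mathbf x+q_0\|<Q^{-v}$, $\|\mathbf q\|\le Q$ has a nonzero solution $(q_0,\mathbf q)\in\mathcal O_K^{m+1}$. *)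

(* Defs.v *)
From HB Require Import structures.
From mathcomp Require Import all_boot all_order all_algebra all_field.
From mathcomp Require Import finmap complex.
From mathcomp Require Import all_classical all_reals all_analysis.
From mathcomp.analysis Require Import showcase.summability.

Set Implicit Arguments.
Unset Strict Implicit.
Unset Printing Implicit Defensive.

Import Order.TTheory GRing.Theory Num.Theory.
Import numFieldNormedType.Exports.

Local Open Scope classical_set_scope.
Local Open Scope ring_scope.

(* A point x of K_S^m is a matrix in 'M[R]_(d, m): row s x is the component
   x^s in K_s^m = R^m, and col j x is the coordinate x_j in K_S = 'cV[R]_d.
   The library norm on matrices is the max norm, which is the norm used here
   both on K_S and on K_S^m. *)

Section NumberField.
Variables (R : realType) (K : fieldExtType rat).

Definition totally_real : Prop :=
  forall (f : {rmorphism K -> R[i]}) (a : K), complex.Im (f a) = 0.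

Definition in_OK (a : K) : Prop := integralOver (intr : int -> K) a.

Definition in_OKm (m : nat) (q : 'rV[K]_m) : Prop := forall j, in_OK (q 0 j).

(* The family sigma lists every embedding K -> R exactly once; morphisms are
   compared pointwise. *)
Definition enumerates_embeddings (d : nat)
    (sigma : 'I_d -> {rmorphism K -> R}) : Prop :=
  (forall s t, sigma s =1 sigma t -> s = t) /\
  (forall f : {rmorphism K -> R}, exists s, f =1 sigma s).

Variables (d m : nat) (sigma : 'I_d -> {rmorphism K -> R}).
Implicit Types (q : 'rV[K]_m) (x : 'M[R]_(d, m)).

Definition diagK (a : K) : 'cV[R]_d := \col_s sigma s a.

Definition diagKm q : 'M[R]_(d, m) := \matrix_(s, j) sigma s (q 0 j).

(* The sum of the products q_j x_j in the ring K_S, taken place by place. *)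
Definition dotKS q x : 'cV[R]_d := \col_s \sum_(j < m) sigma s (q 0 j) * x s j.

Definition singular x : Prop :=
  forall c : R, 0 < c -> \forall Q \near +oo,
    exists (q : 'rV[K]_m) (q0 : K),
      [/\ in_OKm q, in_OK q0, q != 0,
          `|dotKS q x + diagK q0| < c / Q ^+ m & `|diagKm q| <= Q].

Definition totally_irrational x : Prop :=
  forall (q : 'rV[K]_m) (q0 : K), in_OKm q -> in_OK q0 -> q != 0 ->
    exists s : 'I_d, \sum_(j < m) sigma s (q 0 j) * x s j + sigma s q0 != 0.

Definition uniform_exponent x : \bar R :=
  ereal_sup [set v%:E | v in [set v : R | \forall Q \near +oo,
    exists (q0 : K) (q : 'rV[K]_m),
      [/\ in_OK q0, in_OKm q, (q0, q) != (0, 0),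
          `|dotKS q x + diagK q0| < Q `^ (- v) & `|diagKm q| <= Q]]].

Definition affine_K_hyperplane (s : 'I_d) (H : set 'rV[R]_m) : Prop :=
  exists (a : 'rV[K]_m) (b : K), a != 0 /\
    H = [set y | \sum_(j < m) sigma s (a 0 j) * y 0 j + sigma s b = 0].

End NumberField.

Section RealAnalytic.
Variables (R : realType) (m : nat).

(* On a neighbourhood of p, f is the sum of a power series in m variables;
   the sum over multi-indices is unconditional, i.e. absolutely convergent. *)
Definition analytic_at (f : 'rV[R]_m -> R) (p : 'rV[R]_m) : Prop :=
  exists (a : {ffun 'I_m -> nat} -> R) (r : R), 0 < r /\
    forall h : 'rV[R]_m, `|h| < r ->
      partial_sum (fun alpha : {ffun 'I_m -> nat} =>
        a alpha * \prod_(i < m) h 0 i ^+ alpha i) @ totally --> f (p + h).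

Definition analytic_on (U : set 'rV[R]_m) (F : 'rV[R]_m -> 'rV[R]_m) : Prop :=
  forall p, U p -> forall i, analytic_at (fun y => F y 0 i) p.

(* M is a k-dimensional embedded real analytic submanifold of R^m: near each
   of its points an analytic diffeomorphism F : U -> W with inverse G takes
   M to the coordinate subspace where all but the first k coordinates vanish. *)
Definition analytic_submanifold (k : nat) (M : set 'rV[R]_m) : Prop :=
  (k <= m)%N /\
  forall p, M p ->
    exists (U W : set 'rV[R]_m) (F G : 'rV[R]_m -> 'rV[R]_m),
      [/\ [/\ open U, open W & U p],
          analytic_on U F /\ analytic_on W G,
          (forall y, U y -> W (F y) /\ G (F y) = y),
          (forall z, W z -> U (G z) /\ F (G z) = z) &
          forall y, U y ->
            (M y <-> forall i : 'I_m, (k <= i)%N -> F y 0 i = 0)].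

End RealAnalytic.

Definition prodS (R : realType) (d m : nat) (M : 'I_d -> set 'rV[R]_m) :
    set 'M[R]_(d, m) :=
  [set x | forall s, M s (row s x)].

(* Main.v *)
(* Singular points are built as limits of points on rational hyperplanes.
   Write f_q for the affine function y |-> q.y + q_0, taken at every place
   s simultaneously.  Suppose that f_q vanishes at a point z_s of each M_s with
   nonzero derivative along M_s.  As dim M_s >= 2, some coordinate function is
   independent of f_q on the tangent space, and as K is dense in K_S one finds
   a rational affine function g near it that crosses the zero set of f_q close
   to z_s, transversally, at every place.  Moving to the crossing point makes
   |f_q| small compared with any prescribed power of the height of g; iterating
   gives infinite uniform exponent.

   To avoid the zeros of another f_p at one place, replace g by g + l f_q
   with l an integer: all of these vanish at the crossing point, with different
   tangent hyperplanes, and one of these hyperplanes contains a vector where the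
   leading homogeneous form of f_p is nonzero.  That form exists because f_p
   does not vanish identically near any point of M_s, by the identity theorem.
   A totally irrational vector lies on no rational hyperplane, hence
   it is avoided at every step for free; this defeats every enumeration. *)

Require Import Defs.
From HB Require Import structures.
From mathcomp Require Import all_boot all_order all_algebra all_field.
From mathcomp Require Import finmap complex.
From mathcomp Require Import all_classical all_reals all_analysis.
From mathcomp.analysis Require Import showcase.summability.
From mathcomp Require Import ring lra.

Set Implicit Arguments.
Unset Strict Implicit.
Unset Printing Implicit Defensive.

Import Order.TTheory GRing.Theory Num.Theory.
Import numFieldNormedType.Exports.

Local Open Scope classical_set_scope.
Local Open Scope ring_scope.

(** * Real embeddings of a number field *)

Section NumberFieldEmbeddings.
Variables (R : realType) (K : fieldExtType rat).

(** All analysis takes place in chart coordinates, on the subspace [V s] of R^m, with strict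
    differentiability in place of C^1 calculus and the intermediate value theorem in place of the
    implicit function theorem. Three constraints shape the induction. First, |f_q| has to be small
    against a power of the height of the next g, so g must be fixed before the tolerance: the
    refinement step produces g, then suitable points for every T > 0. Second, the hypothesis on f_q
    must be reproduced for g at every place; it is carried by a nonzero 2 x 2 determinant of
    derivatives at the crossing point, which is unchanged when g becomes g + l f_q. Third, the
    exponent is uniform because consecutive stages are linked: if h_i <= Q < h_{i+1} for the
    successive heights, then q_i has height at most Q and |f_{q_i}| < (1 + h_{i+1})^-i. Integer
    factors make the heights unbounded. Total irrationality asks for nonvanishing at one place only,
    so hyperplanes are avoided at a single fixed place [s0]. *)

Lemma rmorph_scale_rat (f : {rmorphism K -> R}) (k : rat) : f (k%:A) = ratr k.
Proof. exact: (fmorph_eq_rat (f \o in_alg K)). Qed.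

Lemma rat_poly_of_primitive (th a : K) : (<<1; th>> = fullv)%VS ->
  exists p : {poly rat}, a = (map_poly (in_alg K) p).[th].
Proof.
move=> thK; have : a \in <<1; th>>%VS by rewrite thK memvf.
move=> /Fadjoin_polyP[q /polyOver1P[p ->] ->]; by exists p.
Qed.

Lemma rmorph_horner_rat (f : {rmorphism K -> R}) (p : {poly rat}) (th : K) :
  f (map_poly (in_alg K) p).[th] = (map_poly ratr p).[f th].
Proof.
rewrite -horner_map -map_poly_comp; congr (_.[_]).
by apply: eq_map_poly => x /=; rewrite rmorph_scale_rat.
Qed.

(** Every element of K is a rational polynomial in a primitive element [th], so an embedding is
    determined by its value at [th]. Such a [th] exists because K, of characteristic 0, is separable
    over the rationals. *)
Lemma embeddings_separated (d : nat) (sigma : 'I_d -> {rmorphism K -> R}) :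
  (forall s t, sigma s =1 sigma t -> s = t) ->
  exists th, injective (fun s => sigma s th).
Proof.
move=> sigma_inj; pose th := separable_generator 1%AS (fullv : {subfield K}).
have thK : (<<1; th>> = fullv)%VS.
  rewrite -eq_adjoin_separable_generator ?sub1v//.
  by apply/separableP => u _; apply: pcharf0_separable => p;
  rewrite (pchar_lalg K); exact: pchar_num.
exists th => s t st; apply: sigma_inj => a.
have [p ->] := rat_poly_of_primitive a thK.
by rewrite !rmorph_horner_rat st.
Qed.

(** If an integer polynomial with leading coefficient [l] kills [a], then l a is integral; taking
    |l| makes the multiplier a natural number. *)
Lemma in_OK_nat_mul (a : K) : exists2 n : nat, (0 < n)%N & in_OK (n%:R * a).
Proof.
have : algebraicOver (in_alg K) a.
  have /polyOver1P[p Ep] := minPolyOver 1%AS a.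
  exists p; last by rewrite -Ep root_minPoly.
  by rewrite -(map_poly_eq0 (in_alg K)) -Ep monic_neq0// monic_minPoly.

move=> [p0 p0_neq0]; have [p [c c_neq0 Ep0]] := rat_poly_scale p0.
have cK : c%:~R != 0 :> rat by rewrite intr_eq0.
have p_neq0 : p != 0.
  by apply: contra_neq p0_neq0 => p0E; rewrite Ep0 p0E map_poly0 scaler0.
rewrite Ep0 map_polyZ rootZ ?fmorph_eq0 ?invr_eq0// -map_poly_comp => pa0.
have {}pa0 : root (map_poly (intr : int -> K) p) a.
  by rewrite -(eq_map_poly (_ : in_alg K \o intr =1 intr))// => x /=;
    rewrite -in_algE rmorph_int.
pose l := lead_coef p; have l_neq0 : l != 0 by rewrite lead_coef_eq0.
suff il : in_OK (l%:~R * a).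
  exists `|l|%N; first by rewrite absz_gt0.
  have [l_ge0|l_lt0] := leP 0 l.
    by rewrite -[_%:R]/(`|l|%N%:Z%:~R) gez0_abs.
  rewrite -[_%:R]/(`|l|%N%:Z%:~R) ltz0_abs// rmorphN mulNr.
  exact: integral_opp.
have [szp|szp] := leqP (size p) 1.
  move: pa0 l_neq0; rewrite /l (size1_polyC szp) map_polyC/= rootC lead_coefC.
  by rewrite -(rmorph_int (in_alg K)) fmorph_eq0 intr_eq0 => ->.
pose n := (size p).-2; have En : size p = n.+2 by rewrite /n; case: (size p) szp => [|[]].
(* Here [p] has degree n+1 and r(l a) = l^n p(a): the factor l^n moves the powers of [l] into the
   variable and leaves a monic polynomial. *)
pose r : {poly int} := 'X^(n.+1) + \poly_(i < n.+1) (p`_i * l ^+ (n - i)).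
exists r.
  rewrite monicE lead_coefDl ?lead_coefXn//.
  by rewrite size_polyXn (leq_ltn_trans (size_poly _ _)).
rewrite /root rmorphD/= map_polyXn hornerD hornerXn.
rewrite (@horner_coef_wide _ n.+1); last first.
  by rewrite (leq_trans (size_poly _ _))// size_poly.
have := pa0; rewrite /root => /eqP/(congr1 (fun z => l%:~R ^+ n * z)).
rewrite mulr0 (@horner_coef_wide _ n.+2); last first.
  by rewrite (leq_trans (size_poly _ _))// En.
rewrite big_ord_recr/= mulrDr addrC mulr_sumr => H; apply/eqP; rewrite -[RHS]H.
congr (_ + _).
  rewrite coef_map/= mulrA exprMn; congr (_ * _).
  by rewrite exprSr -[n.+1]/(n.+2.-1) -En.
apply: eq_bigr => i _; rewrite !coef_map/= coef_poly ltn_ord rmorphM rmorphXn/=.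
rewrite exprMn; have -> : l%:~R ^+ n = l%:~R ^+ (n - i) * l%:~R ^+ i :> K.
  by rewrite -exprD subnK// -ltnS.
ring.
Qed.

Lemma in_OK_common_multiple (I : finType) (a : I -> K) :
  exists2 n : nat, (0 < n)%N & forall i, in_OK (n%:R * a i).
Proof.
have /choice[n Hn] : forall i, exists n : nat, (0 < n)%N /\ in_OK (n%:R * a i).
  by move=> i; have [n] := in_OK_nat_mul (a i); exists n.
exists (\prod_i n i)%N; first by apply: prodn_gt0 => i; have [] := Hn i.
move=> i; rewrite (bigD1 i)//= natrM mulrAC mulrC.
by apply: integral_mul; [exact: integral_nat|have [] := Hn i].
Qed.

(** Lagrange interpolation at the distinct values sigma_s(th) gives a real polynomial [P] with
    P(sigma_s(th)) = tau_s at all places at once. Rational numbers close to its coefficients give a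
    polynomial whose value at [th] is the required element of K. *)
Lemma real_embeddings_dense (d : nat) (sigma : 'I_d -> {rmorphism K -> R}) :
  (forall s t, sigma s =1 sigma t -> s = t) ->
  forall (tau : 'I_d -> R) (e : R), 0 < e ->
  exists a, forall s, `|sigma s a - tau s| < e.
Proof.
move=> sigma_inj tau e e0; have [th th_inj] := embeddings_separated sigma_inj.
pose L s := \prod_(t | t != s) (('X - (sigma t th)%:P) * (sigma s th - sigma t th)^-1%:P).
pose P := \sum_s tau s *: L s.
have LE s t : (L s).[sigma t th] = (s == t)%:R.
  rewrite /L horner_prod; case: eqVneq => [<-|st].
    rewrite big1// => u us; rewrite hornerM hornerXsubC hornerC divff// subr_eq0.
    by apply: contra_neq us => /th_inj.
  by rewrite (bigD1 t) 1?eq_sym//= hornerM hornerXsubC subrr !mul0r.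
have PE t : P.[sigma t th] = tau t.
  rewrite horner_sum (bigD1 t)//= hornerZ LE eqxx mulr1 big1 ?addr0// => s st.
  by rewrite hornerZ LE (negbTE st) mulr0.
pose n := size P.
(* Bounds the sum of the |sigma_s(th)|^i at every place; the summand 1 makes the final inequality
   strict. *)
pose B := 1 + \sum_s \sum_(i < n) `|sigma s th| ^+ i.
have B0 : 0 < B.
  by rewrite ltr_wpDr// sumr_ge0// => s _; rewrite sumr_ge0// => i _; rewrite exprn_ge0.
have /choice[r rP] : forall i : nat, exists r : rat, `|ratr r - P`_i| < e / B.
  move=> i; have [|q] := @rat_in_itvoo R (P`_i - e / B) (P`_i + e / B).
    by rewrite ltrBlDr -addrA ltrDl addr_gt0// divr_gt0.
  by rewrite in_itv/= => qP; exists q; rewrite ltr_distl.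
exists (map_poly (in_alg K) (\poly_(i < n) r i)).[th] => s.
rewrite rmorph_horner_rat -PE (@horner_coef_wide _ n); last first.
  by rewrite (leq_trans (size_poly _ _))// size_poly.
rewrite horner_coef -sumrB (le_lt_trans (ler_norm_sum _ _ _))//.
apply: (@le_lt_trans _ _ (\sum_(i < n) e / B * `|sigma s th| ^+ i)).
  apply: ler_sum => i _; rewrite coef_map/= coef_poly ltn_ord -mulrBl normrM normrX.
  by rewrite ler_wpM2r ?exprn_ge0// ltW.
rewrite -mulr_sumr mulrAC ltr_pdivrMr// ltr_pM2l// /B ltr_pwDl//.
rewrite (bigD1 s)//= lerDl sumr_ge0// => t _.
by rewrite sumr_ge0// => i _; rewrite exprn_ge0.
Qed.

Lemma fieldExt_rat_surj : exists e : nat -> K, forall a, exists n, e n = a.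
Proof.
pose n := \dim (fullv : {vspace K}).
exists (fun i => oapp (VectorInternalTheory.r2v : _ -> K) 0 (choice.unpickle i)) => a.
by exists (choice.pickle (VectorInternalTheory.v2r a)); rewrite choice.pickleK/= VectorInternalTheory.v2rK.
Qed.

End NumberFieldEmbeddings.

(** * Power series in several variables *)

Lemma mx_coord_norm_le (R : realType) (a b : nat) (A : 'M[R]_(a, b)) i j :
  `|A i j| <= `|A|.
Proof.
by rewrite [leRHS]/Num.Def.normr/= mx_normrE; apply/bigmax_geP; right => /=; exists (i, j).
Qed.

Lemma mx_norm_le (R : realType) (a b : nat) (A : 'M[R]_(a, b)) (e : R) :
  0 <= e -> (forall i j, `|A i j| <= e) -> `|A| <= e.
Proof.
move=> e0 Ae; rewrite [leLHS]/Num.Def.normr/= mx_normrE.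
by apply: bigmax_le => // -[i j] _.
Qed.

Lemma mx_norm_lt (R : realType) (a b : nat) (A : 'M[R]_(a, b)) (e : R) :
  0 < e -> (forall i j, `|A i j| < e) -> `|A| < e.
Proof.
move=> e0 Ae; rewrite [ltLHS]/Num.Def.normr/= mx_normrE.
by apply: bigmax_lt => // -[i j] _.
Qed.

#[local] Existing Instance totally_filter.

Section UnconditionalSums.
Variable R : realType.

Lemma partial_sumE (I : choiceType) (x : I -> R) (A : {fset I}) :
  partial_sum x A = \sum_(i <- A) x i.
Proof. by rewrite /partial_sum big_seq_fsetE. Qed.

Lemma sum_fsetU (I : choiceType) (x : I -> R) (A B : {fset I}) :
  [disjoint A & B]%fset ->
  \sum_(i <- (A `|` B)%fset) x i = \sum_(i <- A) x i + \sum_(i <- B) x i.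
Proof.
move=> AB; rewrite -big_cat; apply: perm_big; apply: uniq_perm.
- exact: fset_uniq.
- rewrite cat_uniq !fset_uniq/= andbT; apply/hasPn => i iB.
  by apply: contraL iB; exact: (fdisjointP AB).
- by move=> i; rewrite mem_cat in_fsetU.
Qed.

(** Unconditional convergence in R is absolute. Finite sets disjoint from a suitable [B] have sums
    of size at most 2; outside [B] this is applied to the nonnegative and to the negative terms
    separately, whence the constant 4. *)
Lemma totally_cvg_bounded (I : choiceType) (x : I -> R) (l : R) :
  partial_sum x @ totally --> l ->
  exists C, forall A : {fset I}, \sum_(i <- A) `|x i| <= C.
Proof.
move=> /cvgrPdist_lt/(_ 1 ltr01)[B _ HB].
have SB (A : {fset I}) : (B `<=` A)%fset -> `|l - \sum_(i <- A) x i| < 1.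
  by move=> BA; rewrite -partial_sumE; exact: HB.
have disj (P : {fset I}) : [disjoint B & P]%fset -> `|\sum_(i <- P) x i| <= 2.
  move=> BP; have := SB _ (fsubsetUl B P); have := SB _ (fsubset_refl B).
  rewrite sum_fsetU// !ltr_distl => /andP[? ?] /andP[? ?].
  by rewrite ler_norml; apply/andP; split; lra.
exists (\sum_(i <- B) `|x i| + 4) => A.
pose E := (A `\` B)%fset.
have dE (P : pred I) : [disjoint B & [fset i in E | P i]]%fset.
  by apply/fdisjointP => i iB; rewrite !inE iB.
have AE : \sum_(i <- A) `|x i| <= \sum_(i <- B) `|x i| + \sum_(i <- E) `|x i|.
  rewrite (big_fsetID _ (mem B))/= lerD//; last first.
    rewrite le_eqVlt; apply/orP; left; apply/eqP; apply: eq_fbigl => i.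
    by rewrite !inE/= andbC.
  rewrite [leRHS](big_fsetID _ (mem A))/= ler_wpDr ?sumr_ge0// le_eqVlt.
  by apply/orP; left; apply/eqP; apply: eq_fbigl => i; rewrite !inE/= andbC.
apply: (le_trans AE); rewrite lerD2l (big_fsetID _ (fun i => 0 <= x i))/=.
have := disj _ (dE (fun i => 0 <= x i)); have := disj _ (dE (fun i => ~~ (0 <= x i))).
have -> : \sum_(i <- [fset i in E | 0 <= x i]%fset) `|x i| =
          \sum_(i <- [fset i in E | 0 <= x i]%fset) x i.
  by rewrite !big_seq; apply: eq_bigr => i; rewrite !inE/= => /andP[_ ?]; rewrite ger0_norm.
have -> : \sum_(i <- [fset i in E | ~~ (0 <= x i)]%fset) `|x i| =
          - \sum_(i <- [fset i in E | ~~ (0 <= x i)]%fset) x i.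
  rewrite -sumrN !big_seq; apply: eq_bigr => i; rewrite !inE/= => /andP[_].
  by rewrite -ltNge => ?; rewrite ltr0_norm.
rewrite !ler_norml => /andP[? ?] /andP[? ?]; lra.
Qed.

Lemma cvg_norm_le (u : nat -> R) (l B : R) :
  u @ \oo --> l -> (forall n, `|u n| <= B) -> `|l| <= B.
Proof.
move=> ul uB; rewrite leNgt; apply/negP => Bl.
have e0 : 0 < `|l| - B by rewrite subr_gt0.
move/cvgrPdist_lt : ul => /(_ _ e0)[N _ /(_ N (leqnn N))/= H].
have := ler_dist_dist l (u N); have := uB N.
by have := ler_norm (`|l| - `|u N|); lra.
Qed.

Lemma geometric_tail_le (y : R) (a b : nat) : 0 <= y -> y <= 2^-1 ->
  \sum_(a <= n < b) y ^+ n <= 2 * y ^+ a.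
Proof.
move=> y0 y2; have [ab|ba] := leqP a b; last first.
  by rewrite big_geq ?mulr_ge0 ?exprn_ge0// ltnW.
(* The added 2 y^b stands for the tail still to come; with it the induction on [b] closes because y
   <= 1/2. *)
suff : \sum_(a <= n < b) y ^+ n + 2 * y ^+ b <= 2 * y ^+ a.
  by apply: le_trans; rewrite lerDl mulr_ge0 ?exprn_ge0.
elim: b ab => [|b IH]; first by rewrite leqn0 => /eqP ->; rewrite big_geq ?add0r.
rewrite leq_eqVlt => /orP[/eqP ->|ab]; first by rewrite big_geq ?add0r.
rewrite big_nat_recr//=; apply: le_trans (IH ab).
have : 0 <= y ^+ b by rewrite exprn_ge0.
rewrite exprS; nra.
Qed.

End UnconditionalSums.

Section MultiIndices.
Variables (R : realType) (m : nat).
Implicit Types (u v : 'rV[R]_m) (a : {ffun 'I_m -> nat}).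

Definition mono a u : R := \prod_i u 0 i ^+ a i.
Definition deg a : nat := (\sum_i a i)%N.

(** The type of multi-indices is infinite; the box is a finite set out of which those of a given
    degree can be cut. *)
Definition box (N : nat) : {fset {ffun 'I_m -> nat}} :=
  [fset a in [seq ([ffun i => nat_of_ord (b i)] : {ffun 'I_m -> nat}) |
                b : {ffun 'I_m -> 'I_N.+1}]]%fset.
Definition deg_eq (n : nat) := [fset a in box n | deg a == n]%fset.
Definition deg_lt (n : nat) := [fset a in box n | (deg a < n)%N]%fset.

Lemma le_deg a i : (a i <= deg a)%N.
Proof. by rewrite /deg (bigD1 i)//= leq_addr. Qed.

Lemma in_box a N : (deg a <= N)%N -> a \in box N.
Proof.
move=> aN; rewrite /box inE; apply/mapP.
exists [ffun i => inord (a i)]; first by rewrite mem_enum.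
by apply/ffunP => i; rewrite !ffunE inordK// ltnS (leq_trans (le_deg _ _)).
Qed.

Lemma in_deg_eq n a : (a \in deg_eq n) = (deg a == n).
Proof.
rewrite !inE/=; case: eqP => [an|_]; last by rewrite andbF.
by have := @in_box a n; rewrite an leqnn !inE andbT => /(_ isT) ->.
Qed.

Lemma in_deg_lt n a : (a \in deg_lt n) = (deg a < n)%N.
Proof.
rewrite !inE/=; case: ltnP => [an|_]; last by rewrite andbF.
by have := @in_box a n; rewrite ltnW// !inE andbT => /(_ isT) ->.
Qed.

Lemma sum_deg_lt (F : {ffun 'I_m -> nat} -> R) N :
  \sum_(a <- deg_lt N) F a = \sum_(n < N) \sum_(a <- deg_eq n) F a.
Proof.
elim: N => [|N IH].
  rewrite big_ord0 big1_seq// => a /=; by rewrite in_deg_lt ltn0.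
rewrite big_ord_recr/= -IH -big_cat; apply: perm_big; apply: uniq_perm.
- exact: fset_uniq.
- rewrite cat_uniq !fset_uniq/= andbT; apply/hasPn => a.
  by rewrite in_deg_eq in_deg_lt => /eqP ->; rewrite ltnn.
- by move=> a; rewrite mem_cat !in_deg_lt in_deg_eq ltnS leq_eqVlt orbC.
Qed.

Lemma mono_scale a t u : mono a (t *: u) = t ^+ deg a * mono a u.
Proof.
rewrite /mono /deg -prodrXr -big_split; apply: eq_bigr => i _.
by rewrite mxE exprMn.
Qed.

Lemma mono_const a (t : R) : mono a (const_mx t) = t ^+ deg a.
Proof. by rewrite /mono /deg -prodrXr; apply: eq_bigr => i _; rewrite mxE. Qed.

Lemma mono_line a v u : exists q : {poly R}, forall s, mono a (v + s *: u) = q.[s].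
Proof.
exists (\prod_i ((v 0 i)%:P + u 0 i *: 'X) ^+ a i) => s.
rewrite horner_prod; apply: eq_bigr => i _.
by rewrite horner_exp hornerD hornerC hornerZ hornerX !mxE mulrC.
Qed.

Lemma mono_le a u (r : R) : `|u| <= r -> `|mono a u| <= r ^+ deg a.
Proof.
move=> ur; rewrite /mono /deg -prodrXr normr_prod; apply: ler_prod => i _.
rewrite normr_ge0 normrX; apply: lerXn2r; rewrite ?nnegrE//.
  by rewrite (le_trans _ ur).
exact: le_trans (mx_coord_norm_le _ _ _) ur.
Qed.

(* The extra factor [r] avoids the exponent [deg a - 1]. *)
Lemma mono_lipschitz a u v (r : R) : `|u| <= r -> `|v| <= r ->
  r * `|mono a u - mono a v| <= (deg a)%:R * r ^+ deg a * `|u - v|.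
Proof.
move=> ur vr; have r0 : 0 <= r by rewrite (le_trans _ ur).
have ui i : `|u 0 i| <= r by rewrite (le_trans (mx_coord_norm_le _ _ _)).
have vi i : `|v 0 i| <= r by rewrite (le_trans (mx_coord_norm_le _ _ _)).
have uvi i : `|u 0 i - v 0 i| <= `|u - v|.
  by have := mx_coord_norm_le (u - v) 0 i; rewrite !mxE.
(* A Leibniz rule: estimates of the shape r |x - x'| <= p r^p D multiply, with the degrees p adding
   up. It serves for powers of one coordinate and then for the product over the coordinates. *)
have prodstep (x x' y y' D X Y : R) (p q : nat) :
    `|x'| <= r ^+ p -> `|y| <= r ^+ q -> 0 <= D ->
    r * `|x - x'| <= p%:R * r ^+ p * D -> r * `|y - y'| <= q%:R * r ^+ q * D ->
    r * `|x * y - x' * y'| <= (p + q)%:R * r ^+ (p + q) * D.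
  move=> x'p yq D0 xx yy.
  have -> : x * y - x' * y' = (x - x') * y + x' * (y - y') by ring.
  apply: (le_trans (ler_wpM2l r0 (ler_normD _ _))).
  rewrite mulrDr !normrM natrD exprD !mulrA [r * `|x'|]mulrC -mulrA.
  have h1 : r * `|x - x'| * `|y| <= p%:R * r ^+ p * D * r ^+ q.
    by apply: ler_pM => //; rewrite mulr_ge0.
  have h2 : `|x'| * (r * `|y - y'|) <= r ^+ p * (q%:R * r ^+ q * D).
    by apply: ler_pM => //; rewrite mulr_ge0.
  rewrite !mulrA in h1 h2 *; lra.
have powstep (x y : R) n : `|x| <= r -> `|y| <= r -> `|x - y| <= `|u - v| ->
    r * `|x ^+ n - y ^+ n| <= n%:R * r ^+ n * `|u - v|.
  move=> xr yr xy; elim: n => [|n IH]; first by rewrite subrr normr0 mulr0 !mul0r.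
  rewrite [x ^+ _]exprS [y ^+ _]exprS -add1n; apply: prodstep => //.
  - by rewrite normrX lerXn2r.
  - by rewrite mul1r expr1 ler_wpM2l.
have Xle (x : R) n : `|x| <= r -> `|x ^+ n| <= r ^+ n by move=> xr; rewrite normrX lerXn2r.
have Ple (w : 'rV[R]_m) (s : seq 'I_m) : (forall i, `|w 0 i| <= r) ->
    `|\prod_(i <- s) w 0 i ^+ a i| <= r ^+ (\sum_(i <- s) a i).
  move=> wr; elim: s => [|i s IH]; first by rewrite !big_nil normr1.
  by rewrite !big_cons normrM exprD ler_pM// Xle.
rewrite /mono /deg; elim: (index_enum _) => [|i s IH].
  by rewrite !big_nil subrr normr0 mulr0 !mul0r.
by rewrite !big_cons; apply: prodstep => //; rewrite ?Xle ?Ple// powstep.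
Qed.

Lemma mono_deg1 a : deg a = 1%N -> exists i, forall u, mono a u = u 0 i.
Proof.
move=> a1; have [i ai] : exists i, a i != 0%N.
  apply/existsP; apply: contraPT a1; rewrite negb_exists => /forallP a0.
  rewrite /deg big1// => i _; apply/eqP; have := a0 i; by rewrite negbK.
have ai1 : a i = 1%N.
  by apply/eqP; rewrite eqn_leq lt0n ai andbT -a1 le_deg.
exists i => u; rewrite /mono (bigD1 i)//= ai1 expr1 big1 ?mulr1// => j ji.
move: a1; rewrite /deg (bigD1 i)//= ai1 (bigD1 j)//= => /eqP.
by rewrite -[X in _ == X]addn0 eqn_add2l addn_eq0 => /andP[/eqP -> _]; rewrite expr0.
Qed.

End MultiIndices.

(** * Expansion of an analytic function into homogeneous forms *)

Section HomogeneousExpansion.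
Variables (R : realType) (m : nat).
Implicit Types (f P : 'rV[R]_m -> R) (p u v c : 'rV[R]_m).

Lemma cvg_sum_shift k (F : nat -> R) (l : R) :
  \sum_(n < N) F n @[N --> \oo] --> l -> \sum_(n < N + k) F n @[N --> \oo] --> l.
Proof. by move=> Fl; apply: cvg_comp Fl; exact: cvg_addnr. Qed.

Definition dot c u : R := \sum_i c 0 i * u 0 i.

Definition homogeneous (n : nat) P := forall t u, P (t *: u) = t ^+ n * P u.

(** Together with homogeneity, all that is retained of the forms being polynomials: it gives
    continuity on each line, and finitely many zeros on a line where the form is not identically
    zero. *)
Definition poly_on_lines P :=
  forall v u, exists q : {poly R}, forall s, P (v + s *: u) = q.[s].

(** The series is grouped by degree. At the vector with all coordinates [rho] each monomial equals
    rho^deg, so absolute convergence there yields one constant [C] for the Cauchy-type size and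
    Lipschitz bounds of all forms. *)
Lemma analytic_expansion f p : analytic_at f p ->
  exists (P : nat -> 'rV[R]_m -> R) (C rho : R), [/\ 0 <= C, 0 < rho,
    (forall n, homogeneous n (P n) /\ poly_on_lines (P n)),
    (exists c, P 1%N =1 dot c) &
    [/\ forall n u, `|P n u| <= C * (`|u| / rho) ^+ n,
      forall n u v r, `|u| <= r -> `|v| <= r ->
        r * `|P n u - P n v| <= C * (n%:R * (r / rho) ^+ n) * `|u - v| &
      forall u, `|u| < rho -> \sum_(n < N) P n u @[N --> \oo] --> f (p + u)]].
Proof.
move=> [a [r0 [r0_gt0 Hf]]].
pose x h al := a al * mono al h.
have {}Hf h : `|h| < r0 -> partial_sum (x h) @ totally --> f (p + h) by exact: Hf.
pose P n u := \sum_(al <- deg_eq m n) x u al.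
pose rho := r0 / 2; have rho_gt0 : 0 < rho by rewrite divr_gt0.
have rho_r0 : rho < r0 by rewrite ltr_pdivrMr// mulr_natr mulr2n ltrDl.
have [C0 HC0] : exists C, forall A : {fset {ffun 'I_m -> nat}},
    \sum_(al <- A) `|a al| * rho ^+ deg al <= C.
  have [|C HC] := @totally_cvg_bounded _ _ _ _ (Hf (const_mx rho) _).
    rewrite (le_lt_trans _ rho_r0)//.
    by apply: mx_norm_le => [|i j]; rewrite ?mxE ?gtr0_norm// ltW.
  exists C => A; apply: le_trans (HC A); rewrite le_eqVlt; apply/orP; left; apply/eqP.
  by apply: eq_bigr => al _; rewrite /x mono_const normrM normrX (gtr0_norm rho_gt0).
have C0_ge0 : 0 <= C0 by apply: le_trans (HC0 fset0); rewrite big_seq_fset0.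
have bnd n (r : R) : 0 <= r ->
    \sum_(al <- deg_eq m n) `|a al| * r ^+ n <= C0 * (r / rho) ^+ n.
  move=> r_ge0; rewrite expr_div_n mulrA ler_pdivlMr ?exprn_gt0//.
  rewrite -!mulr_suml mulrAC ler_wpM2r ?exprn_ge0//.
  apply: le_trans (HC0 (deg_eq m n)); rewrite mulr_suml !big_seq.
  by rewrite le_eqVlt; apply/orP; left; apply/eqP; apply: eq_bigr => al;
    rewrite in_deg_eq => /eqP ->.
exists P, C0, rho; split => //.
- move=> n; split.
    move=> t u; rewrite /P mulr_sumr !big_seq; apply: eq_bigr => al.
    by rewrite in_deg_eq => /eqP aln; rewrite /x mono_scale aln mulrCA.
  move=> v u; have /choice[q Hq] := fun al => @mono_line R m al v u.
  exists (\sum_(al <- deg_eq m n) a al *: q al) => s.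
  by rewrite horner_sum; apply: eq_bigr => al _; rewrite hornerZ /x Hq.
(* [None] is the value for multi-indices of degree other than 1, which single out no coordinate. *)
- have /choice[i Hi] : forall al : {ffun 'I_m -> nat}, exists io : option 'I_m,
      deg al = 1%N -> exists2 i, io = Some i & forall u, mono al u = u 0 i :> R.
    move=> al; have [/(mono_deg1 R)[i Hi]|al1] := eqVneq (deg al) 1%N.
      by exists (Some i) => _; exists i.
    by exists None => al1'; rewrite al1' eqxx in al1.
  exists (\row_j \sum_(al <- deg_eq m 1 | i al == Some j) a al) => u.
  rewrite /dot /P; under [RHS]eq_bigr do rewrite mxE mulr_suml.
  rewrite (exchange_big_dep xpredT)//= !big_seq; apply: eq_bigr => al.
  rewrite in_deg_eq => /eqP /Hi[j -> mj]; rewrite /x mj.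
  rewrite (bigD1 j)//= big1 ?addr0// => k /andP[/eqP[->]]; by rewrite eqxx.
- split.
  + move=> n u; apply: le_trans (bnd n _ (normr_ge0 u)).
    apply: (le_trans (ler_norm_sum _ _ _)); rewrite !big_seq; apply: ler_sum => al.
    rewrite in_deg_eq => /eqP aln; rewrite normrM ler_wpM2l// -aln.
    exact: mono_le.
  + move=> n u v r ur vr; have r_ge0 : 0 <= r by rewrite (le_trans _ ur).
    apply: (@le_trans _ _ (\sum_(al <- deg_eq m n) (`|a al| * r ^+ n) * (n%:R * `|u - v|))).
      rewrite /P -sumrB; apply: (le_trans (ler_wpM2l r_ge0 (ler_norm_sum _ _ _))).
      rewrite mulr_sumr !big_seq; apply: ler_sum => al.
      rewrite in_deg_eq => /eqP aln; rewrite /x -mulrBr normrM mulrCA -mulrA ler_wpM2l//.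
      by rewrite mulrA [_ ^+ n * _]mulrC -aln; exact: mono_lipschitz.
    rewrite -mulr_suml [leRHS](_ : _ = C0 * (r / rho) ^+ n * (n%:R * `|u - v|)); last by ring.
    by rewrite ler_wpM2r ?mulr_ge0// bnd.
  + move=> u u_rho; have /cvgrPdist_lt Hu := Hf u (lt_trans u_rho rho_r0).
    apply/cvgrPdist_lt => e /Hu[B _ HB].
    (* Every finite set of multi-indices lies in some [deg_lt m N], so the sums by degree follow the
       filter of finite sets. *)
    have [N HN] : exists N, (B `<=` deg_lt m N)%fset.
      exists (\max_(al <- B) deg al).+1; apply/fsubsetP => al alB.
      by rewrite in_deg_lt ltnS (leq_bigmax_seq al).
    exists N => // k /= Nk.
    have -> : \sum_(n < k) P n u = partial_sum (x u) (deg_lt m k).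
      by rewrite partial_sumE sum_deg_lt.
    apply: HB; apply: (fsubset_trans HN); apply/fsubsetP => al.
    by rewrite !in_deg_lt => /leq_trans; apply.
Qed.

(** Strict differentiability: both points vary. A single estimate at [p] then gives local Lipschitz
    bounds and closeness of the derivatives at nearby points, as C^1 would. *)
Definition sdiff f p c := forall e : R, 0 < e -> exists2 r : R, 0 < r &
  forall y z, `|y - p| < r -> `|z - p| < r ->
    `|f y - f z - dot c (y - z)| <= e * `|y - z|.

Lemma dotB c u v : dot c (u - v) = dot c u - dot c v.
Proof. by rewrite /dot -sumrB; apply: eq_bigr => i _; rewrite !mxE mulrBr. Qed.

(** The derivative is the form of degree 1. The forms of degree n >= 2 change by at most (C/r) n
    (r/rho)^n |u - v|, and these bounds sum to O(r) |u - v|. *)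
Lemma analytic_sdiff f p : analytic_at f p -> exists c, sdiff f p c.
Proof.
move=> /analytic_expansion[P [C [rho [C0 rho0 homP [c Pc] [_ lipP cvgP]]]]].
exists c => e e0.
(* With t = r/rho and n <= 2^n the tail is at most 2 C (2t)^2 = 8 C t^2. The first bound gives 2t <=
   1/2, as the geometric estimate requires; the second makes 8 C t^2 at most r e. *)
pose r := Num.min (rho / 4) (e * rho ^+ 2 / (8 * (C + 1))).
have C1 : 0 < 8 * (C + 1) by rewrite mulr_gt0// ltr_wpDl.
have r0 : 0 < r by rewrite lt_min !divr_gt0// mulr_gt0// exprn_gt0.
have r4 : r <= rho / 4 by rewrite ge_min lexx.
have re : r <= e * rho ^+ 2 / (8 * (C + 1)) by rewrite ge_min lexx orbT.
exists r => // y z yr zr.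
pose u := y - p; pose v := z - p.
have -> : y = p + u by rewrite addrC subrK.
have -> : z = p + v by rewrite addrC subrK.
have -> : p + u - (p + v) = u - v by rewrite opprD addrACA subrr add0r.
have rrho : r < rho by rewrite (le_lt_trans r4)// ltr_pdivrMr// ltr_pMr// ltr1n.
pose w N := \sum_(n < N + 2) P n u - \sum_(n < N + 2) P n v - dot c (u - v).
have cw : w @ \oo --> f (p + u) - f (p + v) - dot c (u - v).
  apply: cvgB; last exact: cvg_cst.
  apply: cvgB.
    exact: (@cvg_sum_shift 2 (P^~ u) _ (cvgP _ (lt_trans yr rrho))).
  exact: (@cvg_sum_shift 2 (P^~ v) _ (cvgP _ (lt_trans zr rrho))).
apply: (cvg_norm_le cw) => N.
have -> : w N = \sum_(2 <= n < N + 2) (P n u - P n v).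
  rewrite /w addn2 -!(big_mkord xpredT (fun n => P n _)).
  rewrite [X in X - _ - _]big_ltn// [X in _ + X - _ - _]big_ltn//.
  rewrite [X in _ - X - _]big_ltn// [X in _ - (_ + X) - _]big_ltn//.
  rewrite -!Pc sumrB.
  have [P0 _] := homP 0%N.
  have -> : P 0%N u = P 0%N v.
    by rewrite -[P 0%N u]mul1r -[P 0%N v]mul1r -[1](expr0 0) -!P0 !scale0r.
  rewrite !Pc !dotB; ring.
rewrite -(ler_pM2l r0).
apply: (@le_trans _ _ (\sum_(2 <= n < N + 2) C * (n%:R * (r / rho) ^+ n) * `|u - v|)).
  apply: (le_trans (ler_wpM2l (ltW r0) (ler_norm_sum _ _ _))); rewrite mulr_sumr.
  by apply: ler_sum => n _; apply: lipP; exact: ltW.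
rewrite -mulr_suml mulrA; apply: ler_wpM2r => //.
pose t := r / rho; have t0 : 0 <= t by rewrite divr_ge0 ?ltW.
have t4 : t <= 1 / 4 by rewrite ler_pdivrMr// mulrC mulrA mulr1.
apply: (@le_trans _ _ (C * (2 * (2 * t) ^+ 2))).
  rewrite -mulr_sumr ler_wpM2l//.
  apply: (@le_trans _ _ (\sum_(2 <= n < N + 2) (2 * t) ^+ n)); last first.
    by apply: geometric_tail_le; [rewrite mulr_ge0|lra].
  apply: ler_sum => n _; rewrite [leRHS]exprMn ler_wpM2r ?exprn_ge0//.
  by rewrite -natrX ler_nat ltnW// ltn_expl.
have tE : t ^+ 2 = r * r / rho ^+ 2 by rewrite /t expr_div_n.
have -> : C * (2 * (2 * t) ^+ 2) = r * ((8 * C * r) / rho ^+ 2).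
  by rewrite exprMn tE; field; rewrite gt_eqF.
rewrite ler_pM2l// ler_pdivrMr ?exprn_gt0//.
move: re; rewrite ler_pdivlMr// => re; apply: le_trans re.
lra.
Qed.

(** [P] is the form of least degree that does not vanish identically on the cone [V]; its degree may
    exceed that of the lowest nonzero form of the expansion. The cone is later a coordinate subspace
    or a single line. *)
Lemma analytic_leading f p (V : set 'rV[R]_m) :
  (forall t u, V u -> V (t *: u)) -> analytic_at f p ->
  (exists2 r, 0 < r & forall u, V u -> `|u| < r -> f (p + u) = 0) \/
  exists (n : nat) P (C r : R), [/\ homogeneous n P, poly_on_lines P,
    (exists2 u, V u & P u != 0), 0 < r /\ 0 <= C &
    forall u, V u -> `|u| < r -> `|f (p + u) - P u| <= C * `|u| ^+ n.+1].
Proof.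
move=> VZ /analytic_expansion[P [C [rho [C0 rho0 homP _ [Ple _ cvgP]]]]].
have [PV|] := pselect (forall n u, V u -> P n u = 0).
  left; exists rho => // u Vu urho; have := cvgP u urho.
  have -> : (fun N => \sum_(n < N) P n u) = fun=> 0.
    by apply/funext => N; rewrite big1// => n _; exact: PV.
  by move=> /cvg_lim <-//; rewrite lim_cst.
move=> PN; have {PN} exP : exists n, `[< exists2 u, V u & P n u != 0 >].
  apply: contrapT => H; apply: PN => n u Vu; apply: contrapT => Pnu.
  by apply: H; exists n; apply/asboolP; exists u => //; apply/eqP.
right; case: (ex_minnP exP) => n /asboolP[u0 Vu0 Pu0] minn.
have Plt k u : V u -> (k < n)%N -> P k u = 0.
  move=> Vu kn; apply/eqP; apply: contraTT kn => Pk; rewrite -leqNgt; apply: minn.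
  by apply/asboolP; exists u.
have [homn linen] := homP n.
exists n, (P n), (C * 2 / rho ^+ n.+1), (rho / 2); split => //.
- by exists u0.
- by rewrite divr_gt0// divr_ge0 ?mulr_ge0 ?exprn_ge0// ltW.
move=> u Vu ur.
have urho : `|u| < rho by rewrite (lt_trans ur)// ltr_pdivrMr// ltr_pMr// ltr1n.
pose w N := \sum_(k < N + n.+1) P k u - P n u.
have cw : w @ \oo --> f (p + u) - P n u.
  apply: cvgB; last exact: cvg_cst.
  exact: (@cvg_sum_shift n.+1 (P^~ u) _ (cvgP _ urho)).
apply: (cvg_norm_le cw) => N.
have -> : w N = \sum_(n.+1 <= k < N + n.+1) P k u.
  rewrite /w -(big_mkord xpredT (fun n => P n _)).
  rewrite (big_cat_nat (n := n.+1))//= ?leq_addl// big_nat_recr//= big_nat big1 ?add0r.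
    by rewrite addrAC subrr add0r.
  by move=> k kn; apply: Plt.
pose t := `|u| / rho; have t0 : 0 <= t by rewrite divr_ge0// ltW.
have t2 : t <= 2^-1 by rewrite ler_pdivrMr// mulrC ltW.
apply: (le_trans (ler_norm_sum _ _ _)).
apply: (@le_trans _ _ (\sum_(n.+1 <= k < N + n.+1) C * t ^+ k)).
  by apply: ler_sum => k _; apply: Ple.
rewrite -mulr_sumr.
have -> : C * 2 / rho ^+ n.+1 * `|u| ^+ n.+1 = C * (2 * t ^+ n.+1).
  by rewrite /t expr_div_n; ring.
by rewrite ler_wpM2l// geometric_tail_le.
Qed.

End HomogeneousExpansion.

(** * Strict differentiability and transversality *)

Section StrictDerivative.
Variables (R : realType) (m : nat).
Implicit Types (f g : 'rV[R]_m -> R) (p u v c d : 'rV[R]_m).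

Lemma dotZr c (t : R) u : dot c (t *: u) = t * dot c u.
Proof. by rewrite /dot mulr_sumr; apply: eq_bigr => i _; rewrite mxE; ring. Qed.

Lemma dotDr c u v : dot c (u + v) = dot c u + dot c v.
Proof. by rewrite /dot -big_split; apply: eq_bigr => i _; rewrite mxE mulrDr. Qed.

Lemma dotDl c d u : dot (c + d) u = dot c u + dot d u.
Proof. by rewrite /dot -big_split; apply: eq_bigr => i _; rewrite mxE mulrDl. Qed.

Lemma dotZl c (t : R) u : dot (t *: c) u = t * dot c u.
Proof. by rewrite /dot mulr_sumr; apply: eq_bigr => i _; rewrite mxE mulrA. Qed.

Lemma dot0l u : dot 0 u = 0.
Proof. by rewrite /dot big1// => i _; rewrite mxE mul0r. Qed.

Lemma dot_le c u : `|dot c u| <= (\sum_i `|c 0 i|) * `|u|.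
Proof.
rewrite /dot mulr_suml (le_trans (ler_norm_sum _ _ _))//.
by apply: ler_sum => i _; rewrite normrM ler_wpM2l// mx_coord_norm_le.
Qed.

Lemma sdiff_lip f p c : sdiff f p c -> exists L r : R, [/\ 0 < L, 0 < r &
  forall y z, `|y - p| < r -> `|z - p| < r -> `|f y - f z| <= L * `|y - z|].
Proof.
move=> /(_ 1 ltr01)[r r0 Hr]; exists (\sum_i `|c 0 i| + 1), r; split => //.
  by rewrite ltr_wpDl// sumr_ge0.
move=> y z yr zr; have := Hr y z yr zr; have := dot_le c (y - z).
rewrite mulrDl mul1r => H1 H2.
by have := ler_normD (f y - f z - dot c (y - z)) (dot c (y - z)); rewrite subrK; lra.
Qed.

Lemma sdiff_continuous f p c : sdiff f p c -> forall e : R, 0 < e ->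
  exists2 r : R, 0 < r & forall y, `|y - p| < r -> `|f y - f p| < e.
Proof.
move=> /sdiff_lip[L [r [L0 r0 HL]]] e e0.
exists (Num.min r (e / L)); first by rewrite lt_min r0 divr_gt0.
move=> y; rewrite lt_min => /andP[yr ye].
have pp : `|p - p| < r by rewrite subrr normr0.
by apply: (le_lt_trans (HL y p yr pp)); rewrite mulrC -ltr_pdivlMr.
Qed.

Lemma sdiffD f g p c d : sdiff f p c -> sdiff g p d -> sdiff (f \+ g) p (c + d).
Proof.
move=> Hf Hg e e0; have e2 : 0 < e / 2 by rewrite divr_gt0.
have [r r0 Hr] := Hf _ e2; have [r' r'0 Hr'] := Hg _ e2.
exists (Num.min r r'); first by rewrite lt_min r0.
move=> y z; rewrite !lt_min => /andP[yr yr'] /andP[zr zr'].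
have := Hr y z yr zr; have := Hr' y z yr' zr'.
have -> : (f \+ g) y - (f \+ g) z - dot (c + d) (y - z) =
   (f y - f z - dot c (y - z)) + (g y - g z - dot d (y - z)).
  by rewrite /= dotDl; ring.
move=> H1 H2; rewrite (le_trans (ler_normD _ _))//.
have -> : e * `|y - z| = e / 2 * `|y - z| + e / 2 * `|y - z| by field.
by rewrite lerD.
Qed.

Lemma sdiffZ f p c (a : R) : sdiff f p c -> sdiff (fun y => a * f y) p (a *: c).
Proof.
move=> Hf e e0; have a1 : 0 < `|a| + 1 by rewrite ltr_wpDl.
have [r r0 Hr] := Hf _ (divr_gt0 e0 a1).
exists r => // y z yr zr; have H := Hr y z yr zr.
rewrite dotZl -!mulrBr normrM.
apply: (@le_trans _ _ ((`|a| + 1) * (e / (`|a| + 1) * `|y - z|))).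
  by rewrite ler_pM// lerDl.
by rewrite mulrA [_ * (e / _)]mulrC divfK// gt_eqF.
Qed.

Lemma sdiff_cst p (b : R) : sdiff (fun=> b) p 0.
Proof.
by move=> e e0; exists 1 => // y z _ _; rewrite dot0l !subr0 subrr normr0 mulr_ge0// ltW.
Qed.

(** Turns a bound on one-sided difference quotients along [v] into information on a strict
    derivative that is not known explicitly. *)
Lemma sdiff_dir f p c v (k K r : R) : sdiff f p c -> 0 < r ->
  (forall t, 0 < t -> t < r -> `|f (p + t *: v) - f p - t * k| <= K * t) ->
  `|dot c v - k| <= K.
Proof.
move=> Hf r0 Hk; rewrite leNgt; apply/negP => Klt.
pose e := (`|dot c v - k| - K) / (2 * (`|v| + 1)).
have v1 : 0 < `|v| + 1 by rewrite ltr_wpDl.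
have e0 : 0 < e by rewrite divr_gt0 ?subr_gt0// mulr_gt0.
have [r' r'0 Hr'] := Hf _ e0.
pose t := Num.min r (r' / (`|v| + 1)) / 2.
have m0 : 0 < Num.min r (r' / (`|v| + 1)) by rewrite lt_min r0 divr_gt0.
have t0 : 0 < t by rewrite divr_gt0.
have tm : t < Num.min r (r' / (`|v| + 1)) by rewrite ltr_pdivrMr// ltr_pMr// ltr1n.
have := tm; rewrite lt_min => /andP[tr tr'].
have := Hk _ t0 tr; have tv : `|p + t *: v - p| < r'.
  rewrite addrAC subrr add0r normrZ gtr0_norm//.
  by move: tr'; rewrite ltr_pdivlMr// => tr'; nra.
have := Hr' _ p tv; rewrite subrr normr0 => /(_ r'0).
rewrite [p + _ - p]addrAC subrr add0r dotZr normrZ (gtr0_norm t0).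
set A := f _ - f p => H1 H2.
have : t * `|dot c v - k| <= K * t + e * (t * `|v|).
  rewrite -{1}(gtr0_norm t0) -normrM mulrBr.
  have -> : t * dot c v - t * k = (A - t * k) - (A - t * dot c v) by ring.
  by rewrite (le_trans (ler_normB _ _))// lerD.
have -> : e * (t * `|v|) = t * (e * `|v|) by ring.
rewrite [K * t]mulrC -mulrDr ler_pM2l// => H3.
have : e * (2 * (`|v| + 1)) = `|dot c v - k| - K by rewrite divfK// gt_eqF// mulr_gt0.
nra.
Qed.

(** Difference quotients at a point [z] near [p] already obey the estimate of strict
    differentiability at [p]. *)
Lemma sdiff_near f p c (e : R) : sdiff f p c -> 0 < e ->
  exists2 r : R, 0 < r & forall z c', `|z - p| < r -> sdiff f z c' ->
    forall v, `|dot c' v - dot c v| <= e * `|v|.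
Proof.
move=> Hf e0; have [r r0 Hr] := Hf _ e0.
exists r => // z c' zr Hz v; have v1 : 0 < `|v| + 1 by rewrite ltr_wpDl.
apply: (@sdiff_dir f z c' v _ _ ((r - `|z - p|) / (`|v| + 1))) => //.
  by rewrite divr_gt0 ?subr_gt0.
move=> t t0; rewrite ltr_pdivlMr// => tr.
have := Hr (z + t *: v) z; rewrite [z + _ - z]addrAC subrr add0r dotZr normrZ gtr0_norm//.
rewrite mulrCA [t * (e * _)]mulrC; apply => //.
rewrite addrAC (le_lt_trans (ler_normD _ _))// normrZ gtr0_norm//.
by move: tr; rewrite mulrDr mulr1; lra.
Qed.

End StrictDerivative.

(** * Common zeros of two transversal functions *)

Section PlanarZero.
Variable R : realType.

Lemma lip_IVT (f : R -> R) (r L : R) : 0 < r -> 0 < L ->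
  (forall x y, `|x| <= r -> `|y| <= r -> `|f x - f y| <= L * `|x - y|) ->
  f (- r) <= 0 -> 0 <= f r -> exists2 x, `|x| <= r & f x = 0.
Proof.
move=> r0 L0 fL f1 f2; have rr : - r <= r by lra.
have fc : {within `[- r, r], continuous f}.
  apply/subspace_continuousP => x /=; rewrite in_itv/= -ler_norml => xr.
  apply/cvgrPdist_lt => e e0; rewrite near_withinE; apply/nbhs_ballP.
  exists (e / L) => /=; first by rewrite divr_gt0.
  move=> y; rewrite /ball/= => xy; rewrite in_itv/= -ler_norml => yr.
  by apply: (le_lt_trans (fL _ _ xr yr)); rewrite mulrC -ltr_pdivlMr.
have [|x xr fx] := IVT rr fc (v := 0).
  by rewrite ge_min le_max f1 f2 orbT.
by exists x => //; move: xr; rewrite in_itv/= -ler_norml.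
Qed.

(** The second equation is solved first: its difference quotients in t are at least 3/4, and the
    solution t = tau(s) is Lipschitz with constant 1/3. Then s -> F1(s, tau(s)) has difference
    quotients at least 2/3 and changes sign, so the intermediate value theorem applies again. *)
Lemma planar_zero (F1 F2 : R -> R -> R) (r : R) : 0 < r ->
  (forall s t s' t', `|s| <= r -> `|t| <= r -> `|s'| <= r -> `|t'| <= r ->
     `|F1 s t - F1 s' t' - (s - s')| <= (`|s - s'| + `|t - t'|) / 4) ->
  (forall s t s' t', `|s| <= r -> `|t| <= r -> `|s'| <= r -> `|t'| <= r ->
     `|F2 s t - F2 s' t' - (t - t')| <= (`|s - s'| + `|t - t'|) / 4) ->
  `|F1 0 0| <= r / 4 -> `|F2 0 0| <= r / 4 ->
  exists s t, [/\ `|s| <= r, `|t| <= r, F1 s t = 0 & F2 s t = 0].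
Proof.
move=> r0 H1 H2 F10 F20.
have r_le : `|r| <= r by rewrite gtr0_norm.
have nr_le : `|- r| <= r by rewrite normrN gtr0_norm.
have z_le : `|0 : R| <= r by rewrite normr0 ltW.
have /choice[tau Htau] : forall s, exists t, `|s| <= r -> `|t| <= r /\ F2 s t = 0.
  move=> s; have [sr|] := boolP (`|s| <= r); last by exists 0.
  have [||||t tr Ft] := @lip_IVT (F2 s) r 2 r0 => //.
  - move=> x y xr yr; have := H2 s x s y sr xr sr yr; rewrite subrr normr0 add0r => H.
    have := ler_normD (F2 s x - F2 s y - (x - y)) (x - y); rewrite subrK; have := normr_ge0 (x - y); lra.
  - have := H2 s (- r) 0 0 sr nr_le z_le z_le; rewrite !subr0 normrN (gtr0_norm r0).
    by move: F20; rewrite !ler_norml => /andP[? ?] /andP[? ?]; lra.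
  - have := H2 s r 0 0 sr r_le z_le z_le; rewrite !subr0 (gtr0_norm r0).
    by move: F20; rewrite !ler_norml => /andP[? ?] /andP[? ?]; lra.
  by exists t.
have tau_lip s s' : `|s| <= r -> `|s'| <= r -> `|tau s - tau s'| <= `|s - s'| / 3.
  move=> sr s'r; have [tr Ft] := Htau _ sr; have [t'r Ft'] := Htau _ s'r.
  have := H2 s (tau s) s' (tau s') sr tr s'r t'r; rewrite Ft Ft' subrr sub0r normrN; lra.
have [||||s sr Fs] := @lip_IVT (fun s => F1 s (tau s)) r 2 r0 => //.
- move=> x y xr yr; have [tx _] := Htau _ xr; have [ty _] := Htau _ yr.
  have := H1 x (tau x) y (tau y) xr tx yr ty; have := tau_lip x y xr yr.
  have := ler_normD (F1 x (tau x) - F1 y (tau y) - (x - y)) (x - y); rewrite subrK.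
  have := normr_ge0 (x - y); lra.
- have [t _] := Htau _ nr_le; have := H1 (- r) (tau (- r)) 0 0 nr_le t z_le z_le.
  rewrite !subr0 normrN (gtr0_norm r0).
  by move: F10 t; rewrite ler_norml => /andP[? ?] t; rewrite ler_norml => /andP[? ?]; lra.
- have [t _] := Htau _ r_le; have := H1 r (tau r) 0 0 r_le t z_le z_le.
  rewrite !subr0 (gtr0_norm r0).
  by move: F10 t; rewrite ler_norml => /andP[? ?] t; rewrite ler_norml => /andP[? ?]; lra.
by have [tr Ft] := Htau _ sr; exists s, (tau s).
Qed.

End PlanarZero.

Section TransversalZero.
Variables (R : realType) (m : nat).
Implicit Types (f g : 'rV[R]_m -> R) (p u v c d : 'rV[R]_m).

Lemma dual_frame (V : set 'rV[R]_m) (c d : 'rV[R]_m) u e :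
  (forall u v, V u -> V v -> V (u + v)) -> (forall t u, V u -> V (t *: u)) ->
  V u -> V e -> dot c u * dot d e - dot c e * dot d u != 0 ->
  exists u' e', [/\ V u', V e', dot c u' = 0 /\ dot d u' = 1 &
                    dot c e' = 1 /\ dot d e' = 0].
Proof.
move=> VD VZ Vu Ve; set D := _ - _ => D0.
exists ((- dot c e / D) *: u + (dot c u / D) *: e).
exists ((dot d e / D) *: u + (- dot d u / D) *: e).
by split; do ?[exact: VD (VZ _ _ _) (VZ _ _ _)]; split;
  rewrite !dotDr !dotZr /D; field.
Qed.

(* [j] is the coordinate whose hyperplanes cross the zero set of [f]; the
   stability under perturbation of [(a, b)] makes room for coefficients in K. *)
Lemma transversal_zero (V : set 'rV[R]_m) (G : 'I_m -> 'rV[R]_m -> R)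
    (cG : 'I_m -> 'rV[R]_m) f p c u e (j : 'I_m) (eps : R) :
  (forall u v, V u -> V v -> V (u + v)) -> (forall t u, V u -> V (t *: u)) ->
  V u -> V e -> (forall i, sdiff (G i) p (cG i)) -> sdiff f p c -> f p = 0 ->
  dot c u = 0 -> dot c e = 1 -> dot (cG j) u = 1 -> dot (cG j) e = 0 ->
  0 < eps ->
  exists2 eta, 0 < eta & forall (a : 'I_m -> R) (b : R),
    (forall i, `|a i - (i == j)%:R| < eta) -> `|b + G j p| < eta ->
    let g y := \sum_i a i * G i y + b in
    exists z, [/\ V (z - p), `|z - p| < eps, f z = 0, g z = 0 &
      forall c' d', sdiff f z c' -> sdiff g z d' ->
        dot c' u * dot d' e - dot c' e * dot d' u != 0].
Proof.
move=> VD VZ Vu Ve dG df fp0 cu ce Gu Ge eps0.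
pose B := `|u| + `|e| + 1; have B0 : 0 < B by rewrite ltr_wpDl// addr_ge0.
have e8 : 0 < (8 * B)^-1 by rewrite invr_gt0 mulr_gt0.
have [rf rf0 Hf] := df _ e8; have [rG rG0 HG] := dG j _ e8.
have /choice[LR HLR] : forall i, exists Lr : R * R, [/\ 0 < Lr.1, 0 < Lr.2 &
    forall y z, `|y - p| < Lr.2 -> `|z - p| < Lr.2 ->
      `|G i y - G i z| <= Lr.1 * `|y - z|].
  by move=> i; have [L [r ?]] := sdiff_lip (dG i); exists (L, r).
have [rL rL0 HrL] : exists2 r : R, 0 < r & forall i, r <= (LR i).2.
  exists (\big[Num.min/1]_i (LR i).2).
    by apply/bigmin_gtP; split => // i _; have [] := HLR i.
  by move=> i; exact: bigmin_le_cond.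
(* Dominates both the Lipschitz constants and the values at [p] of all the [G i]. *)
pose S := \sum_i (LR i).1 + \sum_i `|G i p| + 1.
have S0 : 0 < S.
  by rewrite ltr_wpDl// addr_ge0// sumr_ge0// => i _; have [/ltW] := HLR i.
pose r0 := Num.min (Num.min rf rG) (Num.min rL eps).
have r00 : 0 < r0 by rewrite !lt_min rf0 rG0 rL0 eps0.
(* [Y] maps the square |s|, |t| <= 2r into the ball of radius [r0]. Zeros are sought with |s|, |t|
   <= r, which leaves room for difference quotients at the zero. *)
pose r := r0 / (8 * B); have r_gt0 : 0 < r by rewrite divr_gt0// mulr_gt0.
(* The first bound gives the perturbation of [G j] Lipschitz constant at most 1/(8B); the second
   makes |g(p)| <= r/4. *)
pose eta := Num.min (8 * B * S)^-1 (r / (4 * S)).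
have eta0 : 0 < eta by rewrite lt_min invr_gt0 !mulr_gt0// invr_gt0 mulr_gt0.
exists eta => // a b Ha Hb g.
pose Y s t := p + (s *: u + t *: e).
have Yn s t : `|s *: u + t *: e| <= (`|s| + `|t|) * B.
  rewrite (le_trans (ler_normD _ _))// !normrZ.
  have := normr_ge0 s; have := normr_ge0 t; have := normr_ge0 u; have := normr_ge0 e.
  rewrite /B; nra.
have YB s t s' t' : Y s t - Y s' t' = (s - s') *: u + (t - t') *: e.
  by rewrite /Y opprD addrACA subrr add0r opprD addrACA -!scalerBl.
have Yr s t : `|s| <= 2 * r -> `|t| <= 2 * r -> `|Y s t - p| < r0.
  move=> sr tr; rewrite /Y addrAC subrr add0r (le_lt_trans (Yn s t))//.
  have -> : r0 = 8 * r * B by rewrite /r; field; rewrite gt_eqF.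
  by rewrite ltr_pM2r//; lra.
have Yrs s t : `|s| <= 2 * r -> `|t| <= 2 * r ->
    [/\ `|Y s t - p| < rf, `|Y s t - p| < rG, `|Y s t - p| < eps &
        forall i, `|Y s t - p| < (LR i).2].
  move=> sr tr; have := Yr s t sr tr; rewrite !lt_min => /andP[/andP[-> ->] /andP[h ->]].
  by split => // i; exact: lt_le_trans (HrL i).
have HF s t s' t' : `|s| <= 2 * r -> `|t| <= 2 * r -> `|s'| <= 2 * r -> `|t'| <= 2 * r ->
    `|f (Y s t) - f (Y s' t') - (t - t')| <= (`|s - s'| + `|t - t'|) / 4.
  move=> sr tr s'r t'r; have [h1 _ _ _] := Yrs s t sr tr; have [h2 _ _ _] := Yrs s' t' s'r t'r.
  have := Hf _ _ h1 h2; rewrite YB dotDr !dotZr cu ce mulr0 mulr1 add0r => /le_trans; apply.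
  apply: (@le_trans _ _ ((8 * B)^-1 * ((`|s - s'| + `|t - t'|) * B))).
    by rewrite ler_wpM2l ?invr_ge0 ?mulr_ge0// ltW.
  have -> : (8 * B)^-1 * ((`|s - s'| + `|t - t'|) * B) = (`|s - s'| + `|t - t'|) / 8.
    by field; rewrite gt_eqF.
  have := normr_ge0 (s - s'); have := normr_ge0 (t - t'); lra.
have Hg s t s' t' : `|s| <= 2 * r -> `|t| <= 2 * r -> `|s'| <= 2 * r -> `|t'| <= 2 * r ->
    `|g (Y s t) - g (Y s' t') - (s - s')| <= (`|s - s'| + `|t - t'|) / 4.
  move=> sr tr s'r t'r; have [_ h1 _ hL1] := Yrs s t sr tr; have [_ h2 _ hL2] := Yrs s' t' s'r t'r.
  have := HG _ _ h1 h2; rewrite YB dotDr !dotZr Gu Ge mulr0 mulr1 addr0 => h.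
  have -> : g (Y s t) - g (Y s' t') - (s - s') = (G j (Y s t) - G j (Y s' t') - (s - s')) +
      \sum_i (a i - (i == j)%:R) * (G i (Y s t) - G i (Y s' t')).
    have -> : \sum_i (a i - (i == j)%:R) * (G i (Y s t) - G i (Y s' t')) =
       \sum_i a i * G i (Y s t) - \sum_i a i * G i (Y s' t') -
       \sum_i (i == j)%:R * (G i (Y s t) - G i (Y s' t')).
      by rewrite -!sumrB; apply: eq_bigr => i _; ring.
    have -> : \sum_i (i == j)%:R * (G i (Y s t) - G i (Y s' t')) = G j (Y s t) - G j (Y s' t').
      rewrite (bigD1 j)//= eqxx mul1r big1 ?addr0// => i /negbTE ->; exact: mul0r.
    by rewrite /g; ring.
  rewrite (le_trans (ler_normD _ _))//.
  have k1 : (8 * B)^-1 * `|(s - s') *: u + (t - t') *: e| <= (`|s - s'| + `|t - t'|) / 8.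
    rewrite mulrC ler_pdivrMr ?mulr_gt0// (le_trans (Yn _ _))//.
    by rewrite le_eqVlt; apply/orP; left; apply/eqP; field.
  suff : `|\sum_i (a i - (i == j)%:R) * (G i (Y s t) - G i (Y s' t'))| <=
      (8 * B)^-1 * `|(s - s') *: u + (t - t') *: e| by lra.
  rewrite (le_trans (ler_norm_sum _ _ _))//.
  apply: (@le_trans _ _ (\sum_i eta * ((LR i).1 * `|(s - s') *: u + (t - t') *: e|))).
    apply: ler_sum => i _; rewrite normrM ler_pM//; first exact/ltW/Ha.
    by rewrite -YB; have [_ _] := HLR i; apply.
  rewrite -mulr_sumr -mulr_suml mulrA ler_wpM2r//.
  have etaS : eta <= (8 * B * S)^-1 by rewrite ge_min lexx.
  apply: (@le_trans _ _ (eta * S)).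
    rewrite ler_wpM2l ?(ltW eta0)// /S -addrA lerDl addr_ge0// sumr_ge0//.
  rewrite (le_trans (ler_wpM2r (ltW S0) etaS))// le_eqVlt; apply/orP; left.
  by apply/eqP; field; rewrite !gt_eqF.
have r2 (x : R) : `|x| <= r -> `|x| <= 2 * r by move=> ?; lra.
have Y00 : Y 0 0 = p by rewrite /Y !scale0r !addr0.
have g00 : `|g (Y 0 0)| <= r / 4.
  rewrite Y00; have -> : g p = \sum_i (a i - (i == j)%:R) * G i p + (b + G j p).
    have -> : \sum_i (a i - (i == j)%:R) * G i p = \sum_i a i * G i p - G j p.
      rewrite [X in _ - X](_ : _ = \sum_i (i == j)%:R * G i p); last first.
        by rewrite (bigD1 j)//= eqxx mul1r big1 ?addr0// => i /negbTE ->; exact: mul0r.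
      by rewrite -sumrB; apply: eq_bigr => i _; rewrite mulrBl.
    by rewrite /g; ring.
  have etaS : eta <= r / (4 * S) by rewrite ge_min lexx orbT.
  apply: (@le_trans _ _ (eta * S)); last first.
    rewrite (le_trans (ler_wpM2r (ltW S0) etaS))// le_eqVlt; apply/orP; left.
    by apply/eqP; field; rewrite gt_eqF.
  rewrite (le_trans (ler_normD _ _))// /S mulrDr mulr1 lerD//; last exact: ltW.
  rewrite (le_trans (ler_norm_sum _ _ _))//.
  apply: (@le_trans _ _ (eta * \sum_i `|G i p|)); last first.
    rewrite ler_wpM2l ?(ltW eta0)// lerDr sumr_ge0// => i _; by have [/ltW] := HLR i.
  rewrite mulr_sumr; apply: ler_sum => i _; rewrite normrM ler_wpM2r// ltW//.
have f00 : `|f (Y 0 0)| <= r / 4 by rewrite Y00 fp0 normr0 divr_ge0// ltW.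
(* Along [u] the function g moves at about unit speed and f hardly at all; along [e] the roles are
   exchanged. *)
have [||s [t [sr tr gz fz]]] := @planar_zero _ (fun s t => g (Y s t)) (fun s t => f (Y s t)) r
    r_gt0 _ _ g00 f00.
- by move=> *; apply: Hg; exact: r2.
- by move=> *; apply: HF; exact: r2.
exists (Y s t); have [_ _ zeps _] := Yrs s t (r2 _ sr) (r2 _ tr); split => //.
  by rewrite /Y addrAC subrr add0r; exact: VD (VZ _ _ _) (VZ _ _ _).
have Yu x : Y s t + x *: u = Y (s + x) t by rewrite /Y scalerDl -!addrA; congr (_ + (_ + _)); rewrite addrC.
have Ye x : Y s t + x *: e = Y s (t + x) by rewrite /Y scalerDl !addrA.
have step (x y : R) : `|x| <= r -> 0 < y -> y < r -> `|x + y| <= 2 * r.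
  move=> xr y0 yr; have := ler_normD x y; rewrite (gtr0_norm y0); lra.
move=> c' d' dfz dgz.
(* At the zero, the derivatives of (f, g) are within 1/4 of (0, 1) along [u] and of (1, 0) along
   [e], so the determinant is at most 1/16 - 9/16 < 0. *)
have c'u : `|dot c' u - 0| <= 4^-1.
  apply: (sdiff_dir dfz r_gt0) => y y0 yr; rewrite Yu mulr0.
  have := HF (s + y) t s t (step _ _ sr y0 yr) (r2 _ tr) (r2 _ sr) (r2 _ tr).
  by rewrite subrr [s + _ - s]addrAC subrr add0r (gtr0_norm y0) normr0 addr0 mulrC.
have c'e : `|dot c' e - 1| <= 4^-1.
  apply: (sdiff_dir dfz r_gt0) => y y0 yr; rewrite Ye mulr1.
  have := HF s (t + y) s t (r2 _ sr) (step _ _ tr y0 yr) (r2 _ sr) (r2 _ tr).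
  by rewrite subrr [t + _ - t]addrAC subrr add0r (gtr0_norm y0) normr0 add0r mulrC.
have d'u : `|dot d' u - 1| <= 4^-1.
  apply: (sdiff_dir dgz r_gt0) => y y0 yr; rewrite Yu mulr1.
  have := Hg (s + y) t s t (step _ _ sr y0 yr) (r2 _ tr) (r2 _ sr) (r2 _ tr).
  by rewrite subrr [s + _ - s]addrAC subrr add0r (gtr0_norm y0) normr0 addr0 mulrC.
have d'e : `|dot d' e - 0| <= 4^-1.
  apply: (sdiff_dir dgz r_gt0) => y y0 yr; rewrite Ye mulr0.
  have := Hg s (t + y) s t (r2 _ sr) (step _ _ tr y0 yr) (r2 _ sr) (r2 _ tr).
  by rewrite subrr [t + _ - t]addrAC subrr add0r (gtr0_norm y0) normr0 add0r mulrC.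
move: c'u c'e d'u d'e; rewrite !subr0 !ler_norml => /andP[? ?] /andP[? ?] /andP[? ?] /andP[? ?].
rewrite lt_eqF//; nra.
Qed.

End TransversalZero.

(** * Avoiding the zeros of a further function by means of a pencil *)

Section Avoidance.
Variables (R : realType) (m : nat).
Implicit Types (f g h : 'rV[R]_m -> R) (p u v c d : 'rV[R]_m).

Lemma poly_nat_nonroot (q : {poly R}) (phi : nat -> R) :
  q != 0 -> injective phi -> exists k, q.[phi k] != 0.
Proof.
move=> q0 phi_inj; apply: contrapT => H.
have all_roots : all (root q) (mkseq phi (size q)).
  apply/allP => _ /mapP[k _ ->]; rewrite /root; apply/eqP; apply: contrapT => qk.
  by apply: H; exists k; apply/eqP.
have := max_poly_roots q0 all_roots (mkseq_uniq (size q) phi_inj).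
by rewrite size_mkseq ltnn.
Qed.

Lemma poly_line_lower_bound (P : 'rV[R]_m -> R) u v : poly_on_lines P -> P v != 0 ->
  exists2 r : R, 0 < r & forall s, `|s| <= r -> `|P v| / 2 <= `|P (v + s *: u)|.
Proof.
move=> linP Pv; have [q Hq] := linP v u.
have Pv0 : P v = q.[0] by rewrite -Hq scale0r addr0.
have e0 : 0 < `|P v| / 2 by rewrite divr_gt0// normr_gt0.
have := @continuous_horner R q 0 => /cvgrPdist_lt/(_ _ e0)/nbhs_ballP[r /= r0 Hr].
exists (r / 2); first by rewrite divr_gt0.
move=> s sr; rewrite Hq; have : ball (0 : R) r s.
  by rewrite /ball/= sub0r normrN (le_lt_trans sr)// ltr_pdivrMr// ltr_pMr// ltr1n.
move=> /Hr; rewrite -Pv0 => H.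
by have := ler_dist_dist (P v) q.[s]; have := ler_norm (`|P v| - `|q.[s]|); lra.
Qed.

(* All members g + k f of the pencil vanish at [z], with distinct tangent
   hyperplanes; one of these avoids the zeros of the leading form of [h]. *)
Lemma pencil_avoids (V : set 'rV[R]_m) f g h z c d u e :
  (forall u v, V u -> V v -> V (u + v)) -> (forall t u, V u -> V (t *: u)) ->
  V u -> V e -> sdiff f z c -> sdiff g z d -> f z = 0 -> g z = 0 ->
  dot c u * dot d e - dot c e * dot d u != 0 -> analytic_at h z ->
  ~ (exists2 r, 0 < r & forall u, V u -> `|u| < r -> h (z + u) = 0) ->
  exists k : nat, forall eps, 0 < eps -> exists y, [/\ V (y - z), `|y - z| < eps,
    g y + k%:R * f y = 0, h y != 0 &
    forall d', sdiff (fun y => g y + k%:R * f y) y d' -> exists2 v, V v & dot d' v != 0].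
Proof.
move=> VD VZ Vu Ve df dg fz gz D0 hz hN.
have [u' [e' [Vu' Ve' [cu du] [ce de]]]] := dual_frame VD VZ Vu Ve D0.
have [//|[n [P [C [rh [homP linP [v0 Vv0 Pv0] [rh0 C0] Hh]]]]]] := analytic_leading VZ hz.
(* Along v0 + x e' the form [P] is a nonzero polynomial in x, and [c] is x + c(v0); some natural
   number x is a root of neither. *)
have [v1 [Vv1 Pv1 cv1]] : exists v1, [/\ V v1, P v1 != 0 & dot c v1 != 0].
  have [q Hq] := linP v0 e'.
  have q0 : q * ('X + (dot c v0)%:P) != 0.
    rewrite mulf_neq0//.
      apply: contra_neq Pv0 => q0.
      by rewrite -[v0]addr0 -(scale0r e') Hq q0 horner0.
    by rewrite -size_poly_eq0 size_XaddC.
  have [k] := poly_nat_nonroot q0 (@mulrIn R _ (oner_neq0 R)).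
  rewrite hornerM hornerD hornerX hornerC mulf_eq0 negb_or => /andP[qk ck].
  exists (v0 + k%:R *: e'); split; first exact: VD (VZ _ _ _).
    by rewrite Hq.
  by rewrite dotDr dotZr ce mulr1 addrC.
(* The vector is the projection of [v1] along u' to the kernel of d + k c. Since c(v1) != 0,
   different [k] give different points of one line, on which [P] has finitely many zeros. *)
have [k Pk] : exists k : nat, P (v1 + (- (dot d v1 + k%:R * dot c v1)) *: u') != 0.
  have [q Hq] := linP v1 u'.
  have q0 : q != 0.
    by apply: contra_neq Pv1 => q0; rewrite -[v1]addr0 -(scale0r u') Hq q0 horner0.
  have [|k qk] := @poly_nat_nonroot q (fun k => - (dot d v1 + k%:R * dot c v1)) q0.
    move=> i j /= /oppr_inj/addrI/(mulIf cv1)/eqP; rewrite eqr_nat => /eqP//.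
  by exists k; rewrite Hq.
exists k => eps eps0; set w := v1 + _ in Pk.
pose g' y := g y + k%:R * f y; pose dg' := d + k%:R *: c.
have dg'z : sdiff g' z dg' by exact: sdiffD dg (sdiffZ _ df).
have g'z : g' z = 0 by rewrite /g' gz fz mulr0 addr0.
have Vw : V w by exact: VD (VZ _ _ _).
have dw : dot dg' w = 0 by rewrite dotDl dotZl !dotDr !dotZr cu du; ring.
have du' : dot dg' u' = 1 by rewrite dotDl dotZl cu du mulr0 addr0.
have [del del0 Hdel] := poly_line_lower_bound u' linP Pk.
pose B := `|w| + del * `|u'| + 1.
have B0 : 0 < B by rewrite ltr_wpDl// addr_ge0// mulr_ge0// ltW.
have [L [r1 [L0 r10 HL]]] := sdiff_lip dg'z.
have e1 : 0 < del / (2 * B) by rewrite divr_gt0// mulr_gt0.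
have [r2 r20 Hr2] := dg'z _ e1.
have e2 : 0 < (2 * (`|u'| + 1))^-1 by rewrite invr_gt0 mulr_gt0// ltr_wpDl.
have [r3 r30 Hr3] := sdiff_near dg'z e2.
pose r := Num.min (Num.min r1 r2) (Num.min (Num.min r3 rh) eps).
have r0 : 0 < r by rewrite !lt_min r10 r20 r30 rh0 eps0.
have CB0 : 0 < C * B ^+ n.+1 + 1 by rewrite ltr_wpDl// mulr_ge0// exprn_ge0// ltW.
have Pw0 : 0 < `|P w| by rewrite normr_gt0.
(* The first bound keeps the points in all the balls in use. The second makes the remainder of [h],
   of order t^(n+1), smaller than the lower bound t^n |P w| / 2 of the leading term. *)
pose t := Num.min (r / (2 * B)) (`|P w| / (4 * (C * B ^+ n.+1 + 1))).
have t0 : 0 < t by rewrite lt_min !divr_gt0// mulr_gt0.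
have tB : t * B < r.
  have : t <= r / (2 * B) by rewrite ge_min lexx.
  rewrite ler_pdivlMr ?mulr_gt0//; nra.
have tP : t * (C * B ^+ n.+1) < `|P w| / 2.
  have : t <= `|P w| / (4 * (C * B ^+ n.+1 + 1)) by rewrite ge_min lexx orbT.
  rewrite ler_pdivlMr ?mulr_gt0//; lra.
have wB s : `|s| <= del -> `|w + s *: u'| <= B.
  move=> sd; rewrite (le_trans (ler_normD _ _))// normrZ /B -addrA lerD2l.
  by rewrite ler_wpDr// ler_wpM2r.
(* The points leave [z] in the direction [w], tangent to the zero set of g + k f, with a correction
   s along u' that restores an exact zero: the value is t s up to t del / 2, hence changes sign on
   [-del, del]. *)
pose Y s := z + t *: (w + s *: u').
have YzE s : Y s - z = t *: (w + s *: u') by rewrite /Y addrAC subrr add0r.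
have Yz s : `|s| <= del -> `|Y s - z| < r.
  move=> sd; rewrite YzE normrZ gtr0_norm// (le_lt_trans _ tB)// ler_wpM2l ?(ltW t0)//.
  exact: wB.
have Yr s : `|s| <= del -> [/\ `|Y s - z| < r1, `|Y s - z| < r2, `|Y s - z| < r3,
     `|Y s - z| < rh & `|Y s - z| < eps].
  by move=> /Yz; rewrite !lt_min => /andP[/andP[-> ->] /andP[/andP[-> ->] ->]].
have gY s : `|s| <= del -> `|g' (Y s) - t * s| <= t * (del / 2).
  move=> sd; have [_ hr2 _ _ _] := Yr s sd.
  have := Hr2 _ z hr2; rewrite subrr normr0 => /(_ r20).
  rewrite g'z subr0 YzE dotZr dotDr dotZr dw du' mulr1 add0r => /le_trans; apply.
  rewrite normrZ gtr0_norm// mulrCA ler_wpM2l ?(ltW t0)//.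
  apply: (@le_trans _ _ (del / (2 * B) * B)).
    by rewrite ler_wpM2l ?(ltW e1)// wB.
  by rewrite le_eqVlt; apply/orP; left; apply/eqP; field; rewrite gt_eqF.
have del_le : `|del| <= del by rewrite gtr0_norm.
have ndel_le : `|- del| <= del by rewrite normrN gtr0_norm.
have td0 : 0 < t * del by rewrite mulr_gt0.
have [||||s sd gs] := @lip_IVT R (fun s => g' (Y s)) del (L * (t * (`|u'| + 1))) del0.
- by rewrite !mulr_gt0// ltr_wpDl.
- move=> x y xd yd; have [h1 _ _ _ _] := Yr x xd; have [h2 _ _ _ _] := Yr y yd.
  apply: (le_trans (HL _ _ h1 h2)); rewrite -!mulrA ler_wpM2l ?(ltW L0)//.
  have -> : Y x - Y y = t *: ((x - y) *: u').
    by rewrite /Y opprD addrACA subrr add0r -scalerBr opprD addrACA subrr add0r scalerBl.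
  rewrite normrZ gtr0_norm// ler_wpM2l ?(ltW t0)// normrZ mulrC ler_wpM2r//.
  by rewrite lerDl.
- by have := gY _ ndel_le; rewrite ler_norml => /andP[_]; lra.
- by have := gY _ del_le; rewrite ler_norml => /andP[+ _]; lra.
have [_ _ h3 hh he] := Yr s sd.
exists (Y s); split => //.
- rewrite YzE; exact: VZ (VD _ _ _ (VZ _ _ _)).
- apply/eqP => hY; have VY : V (Y s - z) by rewrite YzE; exact: VZ (VD _ _ _ (VZ _ _ _)).
  have := Hh (Y s - z) VY hh; rewrite [z + _]addrC subrK hY sub0r normrN YzE homP.
  rewrite normrM normrX normrZ (gtr0_norm t0) exprMn exprSr.
  have -> : C * (t ^+ n * t * `|w + s *: u'| ^+ n.+1) =
     t ^+ n * (t * (C * `|w + s *: u'| ^+ n.+1)) by ring.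
  rewrite ler_pM2l ?exprn_gt0// => H.
  have H2 : t * (C * `|w + s *: u'| ^+ n.+1) <= t * (C * B ^+ n.+1).
    rewrite ler_wpM2l ?(ltW t0)// ler_wpM2l// lerXn2r ?nnegrE// ?(ltW B0)//.
    exact: wB.
  by have := Hdel _ sd; lra.
- move=> d' dd'; exists u' => //; have := Hr3 _ _ h3 dd' u'; rewrite du'.
  have : (2 * (`|u'| + 1))^-1 * `|u'| <= 1 / 2.
    by rewrite mulrC ler_pdivrMr ?mulr_gt0 ?ltr_wpDl//; lra.
  move=> h1 h2; have := le_trans h2 h1; rewrite ler_norml => /andP[? ?].
  rewrite gt_eqF//; lra.
Qed.

End Avoidance.

(** * The identity theorem on an analytic submanifold *)

Section AnalyticClosure.
Variables (R : realType) (m : nat).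
Implicit Types (f g : 'rV[R]_m -> R) (p u v w y : 'rV[R]_m).

Lemma analytic_atD f g p : analytic_at f p -> analytic_at g p -> analytic_at (f \+ g) p.
Proof.
move=> [a [r [r0 Ha]]] [b [r' [r'0 Hb]]].
exists (fun al => a al + b al), (Num.min r r'); split; first by rewrite lt_min r0.
move=> h; rewrite lt_min => /andP[hr hr'] /=.
rewrite (_ : partial_sum _ = fun A =>
  partial_sum (fun al => a al * \prod_i h 0 i ^+ al i) A +
  partial_sum (fun al => b al * \prod_i h 0 i ^+ al i) A).
  by apply: cvgD; [exact: Ha|exact: Hb].
apply/funext => A; rewrite /partial_sum -big_split.
by apply: eq_bigr => al _; rewrite mulrDl.
Qed.

Lemma analytic_atZ (c : R) f p : analytic_at f p -> analytic_at (fun y => c * f y) p.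
Proof.
move=> [a [r [r0 Ha]]]; exists (fun al => c * a al), r; split => // h hr.
rewrite (_ : partial_sum _ = fun A =>
  c * partial_sum (fun al => a al * \prod_i h 0 i ^+ al i) A).
  by apply: cvgM; [exact: cvg_cst|exact: Ha].
apply/funext => A; rewrite /partial_sum mulr_sumr.
by apply: eq_bigr => al _; rewrite mulrA.
Qed.

Lemma analytic_at_cst (b : R) p : analytic_at (fun=> b) p.
Proof.
pose al0 : {ffun 'I_m -> nat} := [ffun=> 0%N].
exists (fun al => if al == al0 then b else 0), 1; split => // h _.
apply: cvg_near_cst; exists [fset al0]%fset => // A /=; rewrite fsub1set => A0.
rewrite partial_sumE (big_fsetD1 al0)//= eqxx big1 ?mulr1 ?addr0; last first.
  by move=> i _; rewrite ffunE expr0.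
rewrite big1_seq ?addr0// => al /=; rewrite !inE => /andP[/negbTE ->].
by rewrite mul0r.
Qed.

Lemma analytic_affine (G : 'I_m -> 'rV[R]_m -> R) p (a : 'I_m -> R) (b : R) :
  (forall i, analytic_at (G i) p) -> analytic_at (fun y => \sum_i a i * G i y + b) p.
Proof.
move=> HG; apply: (@analytic_atD (fun y => \sum_i a i * G i y)); last exact: analytic_at_cst.
elim: (index_enum _) => [|i s IH].
  have := analytic_at_cst 0 p; congr analytic_at.
  by apply/funext => y; rewrite big_nil.
have := analytic_atD (analytic_atZ (a i) (HG i)) IH; congr analytic_at.
by apply/funext => y /=; rewrite big_cons.
Qed.

(** On the cone R v the leading form is t^n P(v), which dominates the remainder for small t != 0. *)
Lemma isolated_zero_on_line f p v : analytic_at f p ->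
  (exists2 r : R, 0 < r & forall t, `|t| < r -> f (p + t *: v) = 0) \/
  (exists2 r : R, 0 < r & forall t, 0 < `|t| -> `|t| < r -> f (p + t *: v) != 0).
Proof.
move=> fp; have v1 : 0 < `|v| + 1 by rewrite ltr_wpDl.
have small (r t : R) : `|t| < r / (`|v| + 1) -> `|t *: v| < r.
  rewrite ltr_pdivlMr// => tr; rewrite normrZ (le_lt_trans _ tr)//.
  by rewrite ler_wpM2l// lerDl.
have VZ t u : [set u | exists t : R, u = t *: v] u ->
    [set u | exists t : R, u = t *: v] (t *: u).
  by move=> [t' ->]; exists (t * t'); rewrite scalerA.
have [[r r0 Hr]|[n [P [C [r [homP _ [_ [t0 ->] Pv] [r0 C0] Hr]]]]]] := analytic_leading VZ fp.
  left; exists (r / (`|v| + 1)); first by rewrite divr_gt0.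
  by move=> t tr; apply: Hr; [exists t|exact: small].
have {t0} Pv : P v != 0.
  by apply: contra_neq Pv => Pv; rewrite homP Pv mulr0.
right; pose K := C * `|v| ^+ n.+1 + 1.
have K0 : 0 < K by rewrite ltr_wpDl// mulr_ge0.
exists (Num.min (r / (`|v| + 1)) (`|P v| / K)).
  by rewrite lt_min !divr_gt0// normr_gt0.
move=> t t0; rewrite lt_min => /andP[/small tr]; rewrite ltr_pdivlMr// => tK.
apply/eqP => ft; have := Hr (t *: v) (ex_intro _ t erefl) tr.
rewrite ft sub0r normrN homP normrM normrX normrZ exprMn exprSr.
have -> : C * (`|t| ^+ n * `|t| * `|v| ^+ n.+1) = `|t| ^+ n * (`|t| * (C * `|v| ^+ n.+1)) by ring.
rewrite ler_pM2l ?exprn_gt0//; move: tK; rewrite /K mulrDr; lra.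
Qed.

(** Let [T] be the supremum of the times up to which f vanishes. Zeros accumulate at [T] from the
    left, so the zero there is not isolated and f vanishes a little beyond [T] too; hence T = 1. *)
Lemma analytic_segment_zero f w v (r : R) :
  (forall t, 0 <= t -> t <= 1 -> analytic_at f (w + t *: v)) ->
  0 < r -> (forall t, 0 <= t -> t < r -> f (w + t *: v) = 0) -> f (w + v) = 0.
Proof.
move=> fan r0 fr.
pose E := [set t : R | [/\ 0 <= t, t <= 1 & forall s, 0 <= s -> s <= t -> f (w + s *: v) = 0]].
have E0 : E 0 by split => // s s0 s1; apply: fr => //; exact: le_lt_trans r0.
have Eub : ubound E 1 by move=> t [].
have supE : has_sup E by split; [exists 0|exists 1].
pose T := sup E.
have T0 : 0 <= T by apply: ub_le_sup => //; case: supE.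
have T1 : T <= 1 by apply: ge_sup => //; exists 0.
have ltT s : 0 <= s -> s < T -> f (w + s *: v) = 0.
  rewrite -subr_gt0 => s0 sT; have [t [_ _ tE] st] := sup_adherent sT supE.
  by apply: tE => //; move: st; rewrite -/T; lra.
have Tpos : 0 < T.
  have : E (Num.min (r / 2) 1).
    split; [by rewrite le_min ler01 divr_ge0// ltW|by rewrite ge_min lexx orbT|].
    move=> s s0; rewrite le_min => /andP[sr _]; apply: fr => //.
    by rewrite (le_lt_trans sr)// ltr_pdivrMr// ltr_pMr// ltr1n.
  move=> /(ub_le_sup (proj2 supE)); apply: lt_le_trans.
  by rewrite lt_min ltr01 divr_gt0.
have shift t : w + T *: v + t *: v = w + (T + t) *: v by rewrite scalerDl addrA.
have [[r' r'0 Hr']|[r' r'0 Hr']] := isolated_zero_on_line v (fan _ T0 T1); last first.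
  pose t := Num.min T r' / 2.
  have t0 : 0 < t by rewrite divr_gt0// lt_min Tpos.
  have [tT tr] : t < T /\ t < r'.
    have : t < Num.min T r' by rewrite ltr_pdivrMr// ltr_pMr ?ltr1n// lt_min Tpos.
    by rewrite lt_min => /andP.
  have := Hr' (- t); rewrite normrN gtr0_norm// shift => /(_ t0 tr).
  by rewrite ltT ?eqxx//; lra.
have Hnear s : 0 <= s -> s < T + r' -> f (w + s *: v) = 0.
  move=> s0 sT; have [sT'|Ts] := ltP s T; first exact: ltT.
  have -> : s = T + (s - T) by ring.
  by rewrite -shift; apply: Hr'; rewrite ger0_norm ?subr_ge0//; lra.
have [T1'|T1'] := ltP T 1; last first.
  by rewrite -[v]scale1r; apply: Hnear => //; lra.
have : E (Num.min 1 (T + r' / 2)).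
  split; [by rewrite le_min ler01; lra|by rewrite ge_min lexx|].
  by move=> s s0; rewrite le_min => /andP[_ sT]; apply: Hnear => //; lra.
move=> /(ub_le_sup (proj2 supE)); rewrite -/T ge_min leNgt T1'/=; lra.
Qed.

End AnalyticClosure.

(** * Charts, and the spreading of zeros over a connected submanifold *)

Section Charts.
Variables (R : realType) (m : nat).
Implicit Types (u v w y z : 'rV[R]_m).

Lemma open_norm_ball (U : set 'rV[R]_m) p : open U -> U p ->
  exists2 r : R, 0 < r & forall y, `|y - p| < r -> U y.
Proof.
move=> oU Up; have := open_nbhs_nbhs (conj oU Up) => /nbhs_ballP[r /= r0 Hr].
by exists r => // y yr; apply: Hr; rewrite -ball_normE/= distrC.
Qed.

Definition coord_space (k : nat) : set 'rV[R]_m :=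
  [set u | forall i : 'I_m, (k <= i)%N -> u 0 i = 0].

Lemma coord_spaceD k u v :
  coord_space k u -> coord_space k v -> coord_space k (u + v).
Proof. by move=> Vu Vv i ki; rewrite mxE Vu// Vv// addr0. Qed.

Lemma coord_spaceZ k (t : R) u : coord_space k u -> coord_space k (t *: u).
Proof. by move=> Vu i ki; rewrite mxE Vu// mulr0. Qed.

Lemma coord_spaceB k u v :
  coord_space k u -> coord_space k v -> coord_space k (u - v).
Proof. by move=> Vu Vv; rewrite -scaleN1r; apply: coord_spaceD => //; exact: coord_spaceZ. Qed.

Lemma coord_space_plane k : (2 <= k)%N -> (k <= m)%N ->
  exists v w, [/\ coord_space k v, coord_space k w, v != 0 &
    forall a b : R, a *: v + b *: w = 0 -> a = 0 /\ b = 0].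
Proof.
move=> k2 km; have m0 : (0 < m)%N by rewrite (leq_trans _ km)// (leq_trans _ k2).
have m1 : (1 < m)%N by rewrite (leq_trans _ km).
pose i0 := Ordinal m0; pose i1 := Ordinal m1.
have H : forall a b : R, a *: delta_mx 0 i0 + b *: delta_mx 0 i1 = 0 :> 'rV[R]_m -> a = 0 /\ b = 0.
  move=> a b /rowP H; have := H i0; have := H i1.
  by rewrite !mxE/= !mulr0 !mulr1 add0r addr0.
exists (delta_mx 0 i0), (delta_mx 0 i1); split => //.
- move=> i ki; rewrite mxE/=; case: eqP => // i_0; move: ki; rewrite i_0 leqn0/=.
  by move=> /eqP k0; rewrite k0 in k2.
- move=> i ki; rewrite mxE/=; case: eqP => // i_1; move: ki; rewrite i_1/=.
  by rewrite leqNgt k2.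
- apply/eqP => /rowP/(_ i0); rewrite !mxE/= => /eqP; by rewrite oner_eq0.
Qed.

Definition chart (k : nat) (M U W : set 'rV[R]_m) (F G : 'rV[R]_m -> 'rV[R]_m) :=
  [/\ open U /\ open W, analytic_on U F /\ analytic_on W G,
      (forall y, U y -> W (F y) /\ G (F y) = y),
      (forall z, W z -> U (G z) /\ F (G z) = z) &
      forall y, U y -> (M y <-> coord_space k (F y))].

Lemma submanifold_chart k M p : analytic_submanifold k M -> M p ->
  exists U W F G, chart k M U W F G /\ U p.
Proof.
move=> [_ HM] /HM[U [W [F [G [[oU oW Up] an FK GK MV]]]]].
by exists U, W, F, G.
Qed.

Lemma analytic_on_sdiff (U : set 'rV[R]_m) F z : analytic_on U F -> U z ->
  exists c : 'I_m -> 'rV[R]_m, forall i, sdiff (fun y => F y 0 i) z (c i).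
Proof.
move=> FU Uz; have /choice[c Hc] : forall i, exists ci, sdiff (fun y => F y 0 i) z ci.
  by move=> i; exact: analytic_sdiff (FU z Uz i).
by exists c.
Qed.

Lemma analytic_on_continuous (U : set 'rV[R]_m) F z (e : R) : analytic_on U F -> U z -> 0 < e ->
  exists2 r : R, 0 < r & forall y, `|y - z| < r -> `|F y - F z| < e.
Proof.
move=> FU Uz e0; have [c Hc] := analytic_on_sdiff FU Uz.
have /choice[r Hr] : forall i, exists r : R, 0 < r /\ forall y, `|y - z| < r -> `|F y 0 i - F z 0 i| < e.
  by move=> i; have [r r0 Hr] := sdiff_continuous (Hc i) e0; exists r.
exists (\big[Num.min/1]_i r i); first by apply/bigmin_gtP; split => // i _; have [] := Hr i.
move=> y yr; apply: mx_norm_lt => // j i; rewrite (ord1 j) !mxE; have [_] := Hr i; apply.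
by apply: (lt_le_trans yr); exact: bigmin_le_cond.
Qed.

Section OneChart.
Variables (k : nat) (M U W : set 'rV[R]_m) (F G : 'rV[R]_m -> 'rV[R]_m).
Hypothesis ch : chart k M U W F G.

Lemma chart_mem z : W z -> coord_space k z -> M (G z).
Proof.
move=> Wz Vz; have [_ _ _ GK MV] := ch; have [UG FGz] := GK z Wz.
by apply/(MV _ UG); rewrite FGz.
Qed.

(* [F] is Lipschitz, so the derivative of its inverse [G] has no kernel. *)
Lemma chart_deriv_inj z (cG : 'I_m -> 'rV[R]_m) u : W z ->
  (forall i, sdiff (fun y => G y 0 i) z (cG i)) ->
  (forall i, dot (cG i) u = 0) -> u = 0.
Proof.
move=> Wz dG u0; have [[oU oW] [FU GW] _ GK _] := ch.
have [UG FGz] := GK z Wz; have [cF dF] := analytic_on_sdiff FU UG.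
have u1 : 0 < `|u| + 1 by rewrite ltr_wpDl.
apply/rowP => i; rewrite mxE; apply/eqP; apply: contraT => ui.
have ui0 : 0 < `|u 0 i| by rewrite normr_gt0.
have [L [rF [L0 rF0 HF]]] := sdiff_lip (dF i).
(* If the derivative of G killed [u], then G would move by at most e t |u| from z to z + t u, and
   coordinate i of F(G(z + t u)) = z + t u by at most L e t |u| < t |u_i|. *)
pose e := `|u 0 i| / (2 * L * (`|u| + 1)).
have e0 : 0 < e by rewrite divr_gt0// !mulr_gt0.
have /choice[rG HrG] : forall j, exists r : R, 0 < r /\ forall y, `|y - z| < r ->
    `|G y 0 j - G z 0 j - dot (cG j) (y - z)| <= e * `|y - z|.
  move=> j; have [r r0 Hr] := dG j e e0; exists r; split => // y yr.
  by apply: Hr => //; rewrite subrr normr0.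
have [rc rc0 Hrc] := analytic_on_continuous GW Wz rF0.
have [rW rW0 HrW] := open_norm_ball oW Wz.
pose r := Num.min (\big[Num.min/1]_j rG j) (Num.min rc rW).
have r0 : 0 < r.
  rewrite !lt_min rc0 rW0/= andbT; apply/bigmin_gtP; split => // j _.
  by have [] := HrG j.
pose t := r / (2 * (`|u| + 1)); have t0 : 0 < t by rewrite divr_gt0// mulr_gt0.
have tu : `|t *: u| < r.
  rewrite normrZ gtr0_norm//.
  have : t * (2 * (`|u| + 1)) = r by rewrite divfK// gt_eqF// mulr_gt0.
  nra.
have yz : z + t *: u - z = t *: u by rewrite addrAC subrr add0r.
have := tu; rewrite !lt_min => /andP[tuG /andP[tuc tuW]].
have Wy : W (z + t *: u) by apply: HrW; rewrite yz.
have [_ FGy] := GK _ Wy.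
have GG : `|G (z + t *: u) - G z| <= e * `|t *: u|.
  apply: mx_norm_le; first by rewrite mulr_ge0// ltW.
  move=> j' j; rewrite (ord1 j'); have [_] := HrG j => /(_ (z + t *: u)).
  rewrite yz dotZr u0 mulr0 subr0 !mxE; apply.
  by apply: (lt_le_trans tuG); exact: bigmin_le_cond.
have := HF (G (z + t *: u)) (G z); rewrite subrr normr0 FGy FGz => /(_ _ rF0).
have -> : (z + t *: u) 0 i - z 0 i = t * u 0 i by rewrite !mxE addrAC subrr add0r.
have Hc : `|G (z + t *: u) - G z| < rF by apply: Hrc; rewrite yz.
move=> /(_ Hc) H1; have := le_trans H1 (ler_wpM2l (ltW L0) GG).
rewrite normrM (gtr0_norm t0) normrZ (gtr0_norm t0).
have -> : L * (e * (t * `|u|)) = t * (L * e * `|u|) by ring.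
rewrite ler_pM2l//.
have : L * e * (`|u| + 1) = `|u 0 i| / 2 by rewrite /e; field; rewrite !gt_eqF.
have : 0 < L * e by rewrite mulr_gt0.
nra.
Qed.

Definition aff (a : 'I_m -> R) (b : R) y := \sum_i a i * y 0 i + b.

Lemma aff_chart_analytic a b z : W z -> analytic_at (aff a b \o G) z.
Proof.
move=> Wz; have [_ [_ GW] _ _ _] := ch.
exact: (@analytic_affine _ _ (fun i y => G y 0 i) z a b (GW z Wz)).
Qed.

Lemma aff_chart_sdiff a b z : W z -> exists c, sdiff (aff a b \o G) z c.
Proof. by move=> Wz; apply: analytic_sdiff; exact: aff_chart_analytic. Qed.

(** A segment from [w] to [y] stays in the coordinate subspace and in the ball, which is convex and
    contained in [W]; zeros propagate along it. *)
Lemma chart_zero_ball a b z w (rho r : R) : coord_space k w -> coord_space k z ->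
  (forall y, `|y - z| < rho -> W y) -> `|w - z| < rho -> 0 < r ->
  (forall u, coord_space k u -> `|u| < r -> aff a b (G (w + u)) = 0) ->
  forall y, coord_space k y -> `|y - z| < rho -> aff a b (G y) = 0.
Proof.
move=> Vw Vz Wrho wz r0 Hr y Vy yz; have vy1 : 0 < `|y - w| + 1 by rewrite ltr_wpDl.
have := @analytic_segment_zero _ _ (aff a b \o G) w (y - w) (r / (`|y - w| + 1)).
rewrite [w + _]addrC subrK; apply; last 2 first.
- by rewrite divr_gt0.
- move=> t t0; rewrite ltr_pdivlMr// => tr; apply: Hr; first exact/coord_spaceZ/coord_spaceB.
  by rewrite normrZ ger0_norm// (le_lt_trans _ tr)// ler_wpM2l// lerDl.
move=> t t0 t1; apply: aff_chart_analytic; apply: Wrho.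
have -> : w + t *: (y - w) - z = (1 - t) *: (w - z) + t *: (y - z).
  rewrite scalerBl scale1r !scalerBr; apply/rowP => i; rewrite !mxE; ring.
rewrite (le_lt_trans (ler_normD _ _))// !normrZ !ger0_norm ?subr_ge0//.
have [->|tn1] := eqVneq t 1; first by rewrite subrr mul0r add0r mul1r.
have : 0 < 1 - t by rewrite subr_gt0 lt_neqAle tn1.
nra.
Qed.

End OneChart.

Definition zero_near (M : set 'rV[R]_m) a b p :=
  exists2 r : R, 0 < r & forall y, M y -> `|y - p| < r -> aff a b y = 0.

Lemma zero_near_open M a b : open (zero_near M a b).
Proof.
rewrite openE => p [r r0 Hr]; apply/nbhs_ballP; exists (r / 2) => /=; first by rewrite divr_gt0.
move=> q; rewrite -ball_normE/= => pq; exists (r / 2); first by rewrite divr_gt0.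
move=> y My yq; apply: Hr => //; rewrite -[y - p](subrKA q).
by rewrite (le_lt_trans (ler_normD _ _))// [X in _ + X < _]distrC; lra.
Qed.

(** The points near which the function vanishes on M form a relatively open set. It is relatively
    closed because, in a chart ball around a limit point, zeros spread from any nearby point of the
    set. *)
Lemma identity_theorem k M a b p : analytic_submanifold k M -> connected M ->
  M p -> zero_near M a b p -> forall y, M y -> aff a b y = 0.
Proof.
move=> HM cM Mp Zp; pose Z := M `&` zero_near M a b.
suff ZM : Z = M by move=> y; rewrite -ZM => -[My [r r0]]; apply; rewrite ?subrr ?normr0.
apply: cM; first by exists p.
  by exists (zero_near M a b) => //; exact: zero_near_open.
exists (closure Z); first exact: closed_closure.
apply/seteqP; split => [q Zq|q [Mq clq]]; first by split; [case: Zq|exact: subset_closure].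
split => //; have [U [W [F [G [ch Uq]]]]] := submanifold_chart HM Mq.
have [[oU oW] [FU GW] FK GK MV] := ch.
have [WFq GFq] := FK q Uq; have VFq := (MV q Uq).1 Mq.
have [rho rho0 Wrho] := open_norm_ball oW WFq.
have [r1 r10 Hr1] := analytic_on_continuous FU Uq rho0.
have [r2 r20 Hr2] := open_norm_ball oU Uq.
have r0 : 0 < Num.min r1 r2 by rewrite lt_min r10.
have [q' [[Mq' [e e0 He]] q'q]] : exists q', Z q' /\ `|q' - q| < Num.min r1 r2.
  have [|q' [Zq' Bq']] := clq (ball q (Num.min r1 r2)); first exact: nbhsx_ballx.
  by exists q'; split => //; move: Bq'; rewrite -ball_normE/= distrC.
move: q'q; rewrite lt_min => /andP[q'1 q'2].
have Uq' := Hr2 _ q'2; have [WFq' GFq'] := FK q' Uq'; have VFq' := (MV q' Uq').1 Mq'.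
have [r3 r30 Hr3] := analytic_on_continuous GW WFq' e0.
have [r4 r40 Hr4] := open_norm_ball oW WFq'.
have r34 : 0 < Num.min r3 r4 by rewrite lt_min r30.
have H0 : forall u, coord_space k u -> `|u| < Num.min r3 r4 -> aff a b (G (F q' + u)) = 0.
  move=> u Vu; rewrite lt_min => /andP[u3 u4].
  have uE : F q' + u - F q' = u by rewrite addrAC subrr add0r.
  apply: He; first by apply: (chart_mem ch); [apply: Hr4; rewrite uE|exact: coord_spaceD].
  by rewrite -{2}GFq'; apply: Hr3; rewrite uE.
have H := chart_zero_ball ch VFq' VFq Wrho (Hr1 _ q'1) r34 H0.
exists (Num.min r1 r2) => // y My; rewrite lt_min => /andP[y1 y2].
have Uy := Hr2 _ y2; have [_ GFy] := FK y Uy.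
by rewrite -GFy; apply: H; [exact: (MV y Uy).1|exact: Hr1].
Qed.

Lemma chart_not_locally_zero k M U W F G a b : analytic_submanifold k M -> connected M ->
  chart k M U W F G -> (exists2 y, M y & aff a b y != 0) ->
  forall z, W z -> coord_space k z ->
  ~ (exists2 r, 0 < r & forall u, coord_space k u -> `|u| < r -> (aff a b \o G) (z + u) = 0).
Proof.
move=> HM cM ch [y My hy] z Wz Vz [r r0 Hr].
have [[oU oW] [FU GW] FK GK MV] := ch; have [UG FGz] := GK z Wz.
have [r1 r10 Hr1] := analytic_on_continuous FU UG r0.
have [r2 r20 Hr2] := open_norm_ball oU UG.
have : zero_near M a b (G z).
  exists (Num.min r1 r2); first by rewrite lt_min r10.
  move=> q Mq; rewrite lt_min => /andP[q1 q2]; have Uq := Hr2 _ q2.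
  have [_ GFq] := FK q Uq; have VFq := (MV q Uq).1 Mq.
  have := Hr (F q - z); rewrite /= [z + _]addrC subrK GFq; apply.
    exact: coord_spaceB.
  by rewrite -{1}FGz; exact: Hr1.
move=> /(identity_theorem HM cM (chart_mem ch Wz Vz))/(_ y My) h0.
by rewrite h0 eqxx in hy.
Qed.

(** The projection to a factor is continuous, and it is onto because the other factors are
    nonempty. *)
Lemma connected_prodS_component d (M : 'I_d -> set 'rV[R]_m) s :
  connected (prodS M) -> (forall t, M t !=set0) -> connected (M s).
Proof.
move=> cM /choice[x0 Mx0]; suff -> : M s = row s @` prodS M.
  apply: connected_continuous_connected => //; apply: continuous_subspaceT => x.
  apply/(@cvgrPdist_lt _ _ _ (nbhs x) (nbhs_filter x)) => e e0.
  apply/nbhs_ballP; exists e => // y /=.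
  rewrite -ball_normE/= => xy; apply: mx_norm_lt => // j i.
  apply: le_lt_trans xy; have := mx_coord_norm_le (x - y) s i.
  by rewrite !mxE.
apply/seteqP; split => [y My|_ [x Mx <-]]; last exact: Mx.
exists (\matrix_(t, i) (if t == s then y 0 i else x0 t 0 i)).
  move=> t; have [ts|ts] := eqVneq t s.
    rewrite ts (_ : row s _ = y)//; apply/rowP => i; by rewrite !mxE eqxx.
  rewrite (_ : row t _ = x0 t)//; apply/rowP => i; by rewrite !mxE (negbTE ts).
by apply/rowP => i; rewrite !mxE eqxx.
Qed.

End Charts.

(** * Construction of the singular points *)

Section Frames.
Variables (R : realType) (m : nat).
Implicit Types (u v c : 'rV[R]_m).

(** Dimension at least 2 enters here: a plane in the coordinate subspace meets the kernel of [c] in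
    some u != 0. Injectivity of the chart derivative gives a coordinate [j] varying along [u], and
    subtracting a multiple of [u] from [e] makes it stationary along [e]. *)
Lemma transversal_frame (k : nat) c (cG : 'I_m -> 'rV[R]_m) :
  (2 <= k)%N -> (k <= m)%N ->
  (exists2 v, coord_space k v & dot c v != 0) ->
  (forall u, (forall i, dot (cG i) u = 0) -> u = 0) ->
  exists u e j, [/\ coord_space k u, coord_space k e,
    dot c u = 0 /\ dot c e = 1 & dot (cG j) u = 1 /\ dot (cG j) e = 0].
Proof.
move=> k2 km [v Vv cv] inj.
have [v1 [v2 [Vv1 Vv2 v1_neq0 indep]]] := @coord_space_plane R m k k2 km.
have [u [Vu cu u0]] : exists u, [/\ coord_space k u, dot c u = 0 & u != 0].
  have [cv1|cv1] := eqVneq (dot c v1) 0; first by exists v1.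
  exists (dot c v2 *: v1 + (- dot c v1) *: v2); split.
  - by apply: coord_spaceD; exact: coord_spaceZ.
  - by rewrite dotDr !dotZr; ring.
  - by apply: contra_neq cv1 => /indep[_ /eqP]; rewrite oppr_eq0 => /eqP.
have [j Gu] : exists j, dot (cG j) u != 0.
  apply: contrapT => H; move/eqP : u0; apply; apply: inj => i.
  by apply/eqP; apply: contrapT => Gi; apply: H; exists i; apply/negP.
pose e := (dot c v)^-1 *: v.
exists ((dot (cG j) u)^-1 *: u), (e - (dot (cG j) e / dot (cG j) u) *: u), j.
split; first exact: coord_spaceZ.
- by apply: coord_spaceB; do ?exact: coord_spaceZ.
- by rewrite dotB !dotZr cu !mulr0 subr0 mulVf.
- by rewrite dotB !dotZr mulVf// divfK// subrr.
Qed.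

End Frames.

(** * Inductive refinement of rational hyperplanes *)

Section RationalHyperplanes.
Variables (R : realType) (K : fieldExtType rat) (d m : nat).
Variables (sigma : 'I_d -> {rmorphism K -> R}).
Hypothesis sigma_inj : forall s t, sigma s =1 sigma t -> s = t.
Variables (k : 'I_d -> nat) (M U W : 'I_d -> set 'rV[R]_m).
Variables (F G : 'I_d -> 'rV[R]_m -> 'rV[R]_m).
Hypothesis k2 : forall s, (2 <= k s)%N.
Hypothesis km : forall s, (k s <= m)%N.
Hypothesis ch : forall s, chart (k s) (M s) (U s) (W s) (F s) (G s).

Let V s := coord_space (R := R) (m := m) (k s).

Definition affK (s : 'I_d) (q : 'rV[K]_m) (q0 : K) : 'rV[R]_m -> R :=
  aff (fun i => sigma s (q 0 i)) (sigma s q0).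

Lemma affKD s q q0 p p0 y : affK s (q + p) (q0 + p0) y = affK s q q0 y + affK s p p0 y.
Proof.
rewrite /affK /aff rmorphD addrACA -big_split; congr (_ + _).
by apply: eq_bigr => i _; rewrite mxE rmorphD mulrDl.
Qed.

Lemma affKZ s (n : nat) q q0 y :
  affK s (n%:R *: q) (n%:R * q0) y = n%:R * affK s q q0 y.
Proof.
rewrite /affK /aff rmorphM rmorph_nat mulrDr mulr_sumr; congr (_ + _).
by apply: eq_bigr => i _; rewrite mxE rmorphM rmorph_nat mulrA.
Qed.

Lemma affK_chart_sdiff s q q0 z : W s z -> exists c, sdiff (affK s q q0 \o G s) z c.
Proof. exact: (aff_chart_sdiff (ch s)). Qed.

Lemma eq_sdiff (f g : 'rV[R]_m -> R) p c : f =1 g -> sdiff f p c -> sdiff g p c.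
Proof. by move=> /funext ->. Qed.

Lemma min_pos (I : finType) (r : I -> R) : (forall i, 0 < r i) ->
  exists2 r0 : R, 0 < r0 & forall i, r0 <= r i.
Proof.
move=> rp; exists (\big[Num.min/1]_i r i); first by apply/bigmin_gtP; split.
by move=> i; exact: bigmin_le_cond.
Qed.

(** The crossing coordinate depends on the place, so one coefficient may have to be near 1 at some
    places and near 0 at others; density of K in K_S allows this. Clearing the common denominator
    [n] keeps the zeros and scales the derivatives. *)
Lemma rational_transversal (f : 'I_d -> 'rV[R]_m -> R) (zeta : 'I_d -> 'rV[R]_m)
    (c : 'I_d -> 'rV[R]_m) (eps : R) : 0 < eps ->
  (forall s, W s (zeta s)) -> (forall s, sdiff (f s) (zeta s) (c s)) ->
  (forall s, f s (zeta s) = 0) -> (forall s, exists2 v, V s v & dot (c s) v != 0) ->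
  exists q q0 z, [/\ in_OKm q, in_OK q0 & forall s,
    [/\ V s (z s - zeta s), `|z s - zeta s| < eps, f s (z s) = 0,
        affK s q q0 (G s (z s)) = 0 &
        exists u e, [/\ V s u, V s e & forall c' d', sdiff (f s) (z s) c' ->
          sdiff (affK s q q0 \o G s) (z s) d' ->
          dot c' u * dot d' e - dot c' e * dot d' u != 0]]].
Proof.
move=> eps0 Wz df fz fc.
have /choice[jeta Hjeta] : forall s, exists jeta : 'I_m * R, 0 < jeta.2 /\
    forall (a : 'I_m -> R) b, (forall i, `|a i - (i == jeta.1)%:R| < jeta.2) ->
    `|b + G s (zeta s) 0 jeta.1| < jeta.2 ->
    exists z, [/\ V s (z - zeta s), `|z - zeta s| < eps, f s z = 0, aff a b (G s z) = 0 &
      exists u e, [/\ V s u, V s e & forall c' d', sdiff (f s) z c' ->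
        sdiff (aff a b \o G s) z d' -> dot c' u * dot d' e - dot c' e * dot d' u != 0]].
  move=> s; have [_ [_ GW] _ _ _] := ch s.
  have [cG dG] := analytic_on_sdiff GW (Wz s).
  have [u [e [j [Vu Ve [cu ce] [Gu Ge]]]]] :=
    transversal_frame (k2 s) (km s) (fc s) (fun u => chart_deriv_inj (ch s) (Wz s) dG).
  have [eta eta0 Heta] := transversal_zero (@coord_spaceD R m (k s)) (@coord_spaceZ R m (k s))
    Vu Ve dG (df s) (fz s) cu ce Gu Ge eps0.
  exists (j, eta); split => // a b Ha Hb.
  have [z [Vz ze fz0 gz Hz]] := Heta a b Ha Hb.
  by exists z; split => //; exists u, e.
have [eta eta0 Heta] := min_pos (fun s => (Hjeta s).1).
have /choice[a Ha] : forall i, exists ai, forall s, `|sigma s ai - (i == (jeta s).1)%:R| < eta.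
  by move=> i; apply: real_embeddings_dense.
have [b Hb] := real_embeddings_dense sigma_inj (fun s => - G s (zeta s) 0 (jeta s).1) eta0.
have [n n0 Hn] := in_OK_common_multiple (fun io => oapp a b io).
have nR0 : n%:R != 0 :> R by rewrite pnatr_eq0 -lt0n.
have /choice[z Hz] : forall s, exists z,
    [/\ V s (z - zeta s), `|z - zeta s| < eps, f s z = 0,
        aff (fun i => sigma s (a i)) (sigma s b) (G s z) = 0 &
      exists u e, [/\ V s u, V s e & forall c' d', sdiff (f s) z c' ->
        sdiff (aff (fun i => sigma s (a i)) (sigma s b) \o G s) z d' ->
        dot c' u * dot d' e - dot c' e * dot d' u != 0]].
  move=> s; have [_] := Hjeta s; apply.
    by move=> i; exact: lt_le_trans (Ha i s) (Heta s).
  by apply: lt_le_trans (Heta s); have := Hb s; rewrite opprK.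
pose q : 'rV[K]_m := \row_i a i.
have qE s y : affK s q b y = aff (fun i => sigma s (a i)) (sigma s b) y.
  by rewrite /affK /aff; congr (_ + _); apply: eq_bigr => i _; rewrite mxE.
exists (n%:R *: q), (n%:R * b), z; split.
- by move=> i; rewrite !mxE; exact: (Hn (Some i)).
- exact: (Hn None).
move=> s; have [Vz ze fz0 gz [u [e [Vu Ve Hue]]]] := Hz s; split => //.
  by rewrite affKZ qE gz mulr0.
exists u, e; split => // c' d' dc' dd'.
have dd : sdiff (aff (fun i => sigma s (a i)) (sigma s b) \o G s) (z s) (n%:R^-1 *: d').
  apply: (eq_sdiff _ (sdiffZ n%:R^-1 dd')) => y /=.
  by rewrite affKZ qE mulKf.
have := Hue _ _ dc' dd; rewrite !dotZl; apply: contra_neq => H.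
have -> : dot c' u * (n%:R^-1 * dot d' e) - dot c' e * (n%:R^-1 * dot d' u) =
  n%:R^-1 * (dot c' u * dot d' e - dot c' e * dot d' u) by ring.
by rewrite H mulr0.
Qed.

(** Quantifying over all strict derivatives avoids choosing one; at points of [W s] they exist for
    the functions concerned by [affK_chart_sdiff]. *)
Definition nondegenerate s (g : 'rV[R]_m -> R) z :=
  forall c, sdiff g z c -> exists2 v, V s v & dot c v != 0.

(** A stage of the construction: the current rational hyperplane and, for each place, a closed ball
    in chart coordinates that confines all later choices. *)
Record state := State {
  st_q : 'rV[K]_m; st_q0 : K; st_center : 'I_d -> 'rV[R]_m; st_radius : R }.

Definition good (st : state) : Prop :=
  [/\ in_OKm (st_q st) /\ in_OK (st_q0 st), st_q st != 0, 0 < st_radius st,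
      forall s, V s (st_center st s) /\
        forall y, `|y - st_center st s| <= st_radius st -> W s y &
      forall s, affK s (st_q st) (st_q0 st) (G s (st_center st s)) = 0 /\
        nondegenerate s (affK s (st_q st) (st_q0 st) \o G s) (st_center st s)].

Definition height (q : 'rV[K]_m) : R := `|diagKm sigma q|.

Lemma heightZ (n : nat) q : height (n%:R *: q) = n%:R * height q.
Proof.
rewrite /height -[n%:R in RHS]normr_nat -normrZ; congr `|_|.
by apply/matrixP => s j; rewrite !mxE rmorphM rmorph_nat.
Qed.

Lemma height_gt0 (s : 'I_d) q : q != 0 -> 0 < height q.
Proof.
move=> q0; rewrite /height normr_gt0; apply: contra_neq q0 => /matrixP H.
apply/rowP => j; have := H s j; rewrite !mxE => /eqP.
by rewrite fmorph_eq0 => /eqP.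
Qed.

Lemma nondegenerate_neq0 s q q0 z : nondegenerate s (affK s q q0 \o G s) z -> q != 0.
Proof.
move=> H; apply/eqP => qz.
have [|v _] := H 0; last by rewrite dot0l eqxx.
apply: (eq_sdiff _ (sdiff_cst z (sigma s q0))) => y /=.
rewrite /affK /aff big1 ?add0r// => i _; by rewrite qz mxE rmorph0 mul0r.
Qed.

Lemma nondegenerateZ s (n : nat) q q0 z : (0 < n)%N ->
  nondegenerate s (affK s q q0 \o G s) z ->
  nondegenerate s (affK s (n%:R *: q) (n%:R * q0) \o G s) z.
Proof.
move=> n0 H c dc; have nR0 : n%:R != 0 :> R by rewrite pnatr_eq0 -lt0n.
have [|v Vv cv] := H (n%:R^-1 *: c).
  by apply: (eq_sdiff _ (sdiffZ n%:R^-1 dc)) => y /=; rewrite affKZ mulKf.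
by exists v => //; move: cv; rewrite dotZl mulf_eq0 negb_or => /andP[].
Qed.

Variable s0 : 'I_d.
Hypothesis HM0 : analytic_submanifold (k s0) (M s0).
Hypothesis cM0 : connected (M s0).
Hypothesis not_in_hyperplane :
  forall p p0, p != 0 -> exists2 y, M s0 y & affK s0 p p0 y != 0.

(** The new hyperplane does not depend on [T], which is later a negative power of an expression in
    its height. *)
Lemma refine_hyperplane (st : state) (n : nat) p p0 : good st -> p != 0 ->
  exists q q0, [/\ in_OKm q, in_OK q0, q != 0, n%:R <= height q &
   forall (T : R), 0 < T -> forall s, exists y, [/\ V s y,
     `|y - st_center st s| < st_radius st,
     `|affK s (st_q st) (st_q0 st) (G s y)| < T,
     affK s q q0 (G s y) = 0 /\ nondegenerate s (affK s q q0 \o G s) y &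
     s = s0 -> affK s p p0 (G s y) != 0]].
Proof.
case: st => qa qb zeta rho [/= [iqa iqb] qa0 rho0 Vz Hz] p_neq0.
have Wz s : W s (zeta s) by apply: (Vz s).2; rewrite subrr normr0 ltW.
pose f s := affK s qa qb \o G s.
have /choice[c df] : forall s, exists c, sdiff (f s) (zeta s) c.
  by move=> s; exact: affK_chart_sdiff.
have rho2 : 0 < rho / 2 by rewrite divr_gt0.
have [q1 [q10 [z [iq1 iq10 H1]]]] := rational_transversal rho2 Wz df
  (fun s => (Hz s).1) (fun s => (Hz s).2 _ (df s)).
have zrho s : `|z s - zeta s| < rho.
  by have [_ + _ _ _] := H1 s; lra.
have Wz1 s : W s (z s) by apply: (Vz s).2; exact/ltW/zrho.
have Vz1 s : V s (z s).
  have [Vd _ _ _ _] := H1 s; rewrite -[z s](subrK (zeta s)).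
  by apply: coord_spaceD => //; exact: (Vz s).1.
have [l Hl] : exists l : nat, forall eps, 0 < eps -> exists y,
    [/\ V s0 (y - z s0), `|y - z s0| < eps,
     affK s0 q1 q10 (G s0 y) + l%:R * f s0 y = 0, affK s0 p p0 (G s0 y) != 0 &
     nondegenerate s0 (fun y => affK s0 q1 q10 (G s0 y) + l%:R * f s0 y) y].
  have [_ _ fz gz [u [e [Vu Ve Hue]]]] := H1 s0.
  have [cf dcf] := affK_chart_sdiff qa qb (Wz1 s0).
  have [cg dcg] := affK_chart_sdiff q1 q10 (Wz1 s0).
  exact: (pencil_avoids (@coord_spaceD R m (k s0)) (@coord_spaceZ R m (k s0)) Vu Ve
    dcf dcg fz gz (Hue _ _ dcf dcg) (aff_chart_analytic (ch s0) _ _ (Wz1 s0))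
    (chart_not_locally_zero HM0 cM0 (ch s0) (not_in_hyperplane p0 p_neq0) (Wz1 s0) (Vz1 s0))).
(* The integer [l] found at [s0] acts at every place; elsewhere the crossing point [z s] remains
   valid, as both functions vanish there. *)
pose q2 := q1 + l%:R *: qa; pose q20 := q10 + l%:R * qb.
have q2E s y : affK s q2 q20 (G s y) = affK s q1 q10 (G s y) + l%:R * f s y.
  by rewrite affKD affKZ.
(* Adding l f to g leaves the determinant unchanged, so the new derivative cannot vanish on both [u]
   and [e]. *)
have nondeg s : nondegenerate s (affK s q2 q20 \o G s) (z s).
  have [_ _ _ _ [u [e [Vu Ve Hue]]]] := H1 s => c' dc'.
  have [cf dcf] := affK_chart_sdiff qa qb (Wz1 s).
  have dcg : sdiff (affK s q1 q10 \o G s) (z s) (c' + (- l%:R) *: cf).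
    apply: (eq_sdiff _ (sdiffD dc' (sdiffZ (- l%:R) dcf))) => y /=.
    by rewrite q2E /f /=; ring.
  have := Hue _ _ dcf dcg; rewrite !dotDl !dotZl => H.
  have [c'u|c'u] := eqVneq (dot c' u) 0; last by exists u.
  exists e => //; apply: contra_neq H => c'e; rewrite c'u c'e; ring.
have q2_neq0 : q2 != 0 := nondegenerate_neq0 (nondeg s0).
have h2 := height_gt0 s0 q2_neq0.
(* An integer factor keeps the zero sets and raises the height to at least [n]. *)
pose N := (Num.bound (n%:R / height q2)).+1.
have N0 : (0 < N)%N by [].
have NR : N%:R != 0 :> K by rewrite -(rmorph_nat (in_alg K)) fmorph_eq0 pnatr_eq0.
have iOKD a b : in_OK a -> in_OK b -> in_OK (a + b :> K).
  by move=> ? ?; exact: integral_add.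
have iOKn (j : nat) a : in_OK a -> in_OK (j%:R * a :> K).
  by move=> ?; apply: integral_mul => //; exact: integral_nat.
exists (N%:R *: q2), (N%:R * q20); split.
- move=> i; rewrite !mxE; apply: (iOKn); apply: (iOKD); first exact: iq1.
  apply: (iOKn); exact: iqa.
- by apply: (iOKn); apply: (iOKD) => //; exact: (iOKn).
- by rewrite scaler_eq0 negb_or NR.
- rewrite heightZ -ler_pdivrMr// ltW//.
  have /(lt_le_trans)-> // : n%:R / height q2 < (Num.bound (n%:R / height q2))%:R.
    by apply: archi_boundP; rewrite divr_ge0// ltW.
  by rewrite ler_nat /N.
move=> T T0 s; have [ss0|ss0] := eqVneq s s0; last first.
  exists (z s); have [_ _ fz gz _] := H1 s; split => //.
  - by have -> : affK s qa qb (G s (z s)) = 0 := fz; rewrite normr0.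
  - by split; [rewrite affKZ q2E gz fz mulr0 addr0 mulr0|exact: nondegenerateZ].
  - by move=> ss; rewrite ss eqxx in ss0.
(* At [s0] the point need no longer be a zero of f; it is taken close enough to [z s0] for |f| <
   T. *)
rewrite ss0; have [cf dcf] := affK_chart_sdiff qa qb (Wz1 s0).
have [r r0 Hr] := sdiff_continuous dcf T0.
have e0 : 0 < Num.min r (rho / 2) by rewrite lt_min r0.
have [y [Vy ye gy hy ny]] := Hl _ e0.
move: ye; rewrite lt_min => /andP[yr yrho].
exists y; split => //.
- by rewrite -[y](subrK (z s0)); exact: coord_spaceD Vy (Vz1 s0).
- rewrite -(subrKA (z s0)) (le_lt_trans (ler_normD _ _))//.
  by have [_ + _ _ _] := H1 s0; lra.
- have := Hr y yr; have [_ _ fz _ _] := H1 s0.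
  have -> : (affK s0 qa qb \o G s0) (z s0) = 0 := fz.
  by rewrite subr0.
- split; first by rewrite affKZ q2E gy mulr0.
  apply: nondegenerateZ => //.
  have -> : affK s0 q2 q20 \o G s0 = fun y => affK s0 q1 q10 (G s0 y) + l%:R * f s0 y.
    by apply/funext => y' /=; rewrite q2E.
  exact: ny.
Qed.

Lemma sdiff_neq_near (f : 'rV[R]_m -> R) p c (b : R) : sdiff f p c -> f p != b ->
  exists2 r : R, 0 < r & forall y, `|y - p| < r -> f y != b.
Proof.
rewrite -subr_eq0 -normr_gt0 => df fb; have [r r0 Hr] := sdiff_continuous df fb.
exists r => // y /Hr; apply: contraTneq => ->; by rewrite -leNgt distrC.
Qed.

(** The base 1 + height is at least 1, so its negative powers do not increase with [n]. The guard p
    != 0 is there because the enumeration of pairs also yields p = 0. *)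
Definition refines (n : nat) p p0 (x : 'M[R]_(d, m)) (st st' : state) : Prop :=
  [/\ st_radius st' <= st_radius st / 2,
      n%:R <= height (st_q st') &
      forall s y, `|y - st_center st' s| <= st_radius st' ->
        [/\ `|y - st_center st s| <= st_radius st,
          `|affK s (st_q st) (st_q0 st) (G s y)| < (1 + height (st_q st')) ^- n,
          p != 0 -> s = s0 -> affK s p p0 (G s y) != 0 &
          totally_irrational sigma x -> exists s1, forall y1,
            `|y1 - st_center st' s1| <= st_radius st' -> G s1 y1 != row s1 x]].

Lemma refines_exists (st : state) (n : nat) p p0 x : good st ->
  exists st', good st' /\ refines n p p0 x st st'.
Proof.
(* For p = 0 nothing is to be avoided, and [st_q st] serves as a dummy. *)
move=> gst; have [p' [p'_neq0 Ep']] : exists p', p' != 0 /\ (p != 0 -> p' = p).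
  have [->|p_neq0] := eqVneq p 0; last by exists p.
  exists (st_q st); split => //; by case: gst.
have [q [q0 [iq iq0 q_neq0 nq Hq]]] := refine_hyperplane n p0 gst p'_neq0.
have T0 : 0 < (1 + height q) ^- n by rewrite invr_gt0 exprn_gt0// ltr_wpDr// ltW// (height_gt0 s0).
have /choice[zeta Hzeta] := Hq _ T0.
have [[iqa iqb] qa0 rho0 Vz Hz] := gst.
have Wzeta s : W s (zeta s) by apply: (Vz s).2; have [_ /ltW] := Hzeta s.
(* At [s1] the new hyperplane passes through the new centre but misses x, so a small ball around the
   centre avoids x. *)
have [s1 Hs1] : exists s1, totally_irrational sigma x -> affK s1 q q0 (row s1 x) != 0.
  have [tx|] := pselect (totally_irrational sigma x); last by exists s0.
  have [s1 Hs1] := tx q q0 iq iq0 q_neq0; exists s1 => _; rewrite /affK /aff.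
  by under eq_bigr do rewrite mxE.
have /choice[r Hr] : forall s, exists r : R, 0 < r /\ forall y, `|y - zeta s| < r ->
    [/\ `|y - st_center st s| <= st_radius st,
        `|affK s (st_q st) (st_q0 st) (G s y)| < (1 + height q) ^- n,
        p != 0 -> s = s0 -> affK s p p0 (G s y) != 0 &
        totally_irrational sigma x -> s = s1 -> G s y != row s x].
  move=> s; have [Vy yrho fT [qy _] hy] := Hzeta s.
  have [ca da] := affK_chart_sdiff (st_q st) (st_q0 st) (Wzeta s).
  have [r1 r10 Hr1] : exists2 r : R, 0 < r & forall y, `|y - zeta s| < r ->
      `|affK s (st_q st) (st_q0 st) (G s y)| < (1 + height q) ^- n.
    move: fT; rewrite -subr_gt0 => fT; have [r r0 Hr] := sdiff_continuous da fT.
    exists r => // y /Hr /= H.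
    have := ler_normD (affK s (st_q st) (st_q0 st) (G s y) -
      affK s (st_q st) (st_q0 st) (G s (zeta s))) (affK s (st_q st) (st_q0 st) (G s (zeta s))).
    by rewrite subrK; lra.
  have [r2 r20 Hr2] : exists2 r : R, 0 < r & forall y, `|y - zeta s| < r ->
      p != 0 -> s = s0 -> affK s p p0 (G s y) != 0.
    have [[/Ep' pp' ss0]|N] := pselect (p != 0 /\ s = s0); last first.
      by exists 1 => // y _ pn ss; case: N.
    have [cp dp] := affK_chart_sdiff p p0 (Wzeta s).
    have [|r r0 Hr] := sdiff_neq_near (b := 0) dp; first by rewrite /= -pp' hy.
    by exists r => // y /Hr.
  have [r3 r30 Hr3] : exists2 r : R, 0 < r & forall y, `|y - zeta s| < r ->
      totally_irrational sigma x -> s = s1 -> G s y != row s x.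
    have [[tx ss1]|N] := pselect (totally_irrational sigma x /\ s = s1); last first.
      by exists 1 => // y _ tx ss; case: N.
    have [cq dq] := affK_chart_sdiff q q0 (Wzeta s).
    have [|r r0 Hr] := sdiff_neq_near (b := affK s q q0 (row s x)) dq.
      by rewrite /= qy eq_sym ss1 Hs1.
    by exists r => // y /Hr yx _ _; apply: contra_neq yx => /= ->.
  pose r4 := st_radius st - `|zeta s - st_center st s|.
  have r40 : 0 < r4 by rewrite subr_gt0.
  exists (Num.min (Num.min r1 r2) (Num.min r3 r4)); split.
    by rewrite !lt_min r10 r20 r30.
  move=> y; rewrite !lt_min => /andP[/andP[y1 y2] /andP[y3 y4]]; split.
  - rewrite -(subrKA (zeta s)) (le_trans (ler_normD _ _))//.
    by move: y4; rewrite /r4; lra.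
  - exact: Hr1.
  - exact: Hr2.
  - exact: Hr3.
have [r0 r00 Hr0] := min_pos (fun s => (Hr s).1).
(* The first half makes estimates on open balls hold on a closed one; the second forces the radii to
   0. *)
pose rho' := Num.min (r0 / 2) (st_radius st / 2).
have rho'0 : 0 < rho' by rewrite lt_min !divr_gt0.
have rho'r s y : `|y - zeta s| <= rho' -> `|y - zeta s| < r s.
  rewrite /rho' le_min => /andP[h _]; have := Hr0 s; lra.
exists (State q q0 zeta rho'); split.
  split => // s.
    have [Vy _ _ _ _] := Hzeta s; split => // y /rho'r yr; apply: (Vz s).2.
    by have [_ /(_ y yr)[]] := Hr s.
  by have [_ _ _ ? _] := Hzeta s.
split => //=; first by rewrite /rho' ge_min lexx orbT.
move=> s y yr; have [_ /(_ y (rho'r _ _ yr))[h1 h2 h3 _]] := Hr s; split => //.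
move=> tx; exists s1 => y1 y1r.
by have [_ /(_ y1 (rho'r _ _ y1r))[_ _ _]] := Hr s1; apply.
Qed.

(** With no rational hyperplane at hand yet, the first chart coordinate, shifted to vanish at the
    base point, plays the role of f. *)
Lemma good_exists : (forall s, exists z, W s z /\ V s z) -> exists st, good st.
Proof.
move=> /choice[z0 Hz0].
have m0 : (0 < m)%N by rewrite (leq_trans _ (km s0))// (leq_trans _ (k2 s0)).
pose c : 'rV[R]_m := delta_mx 0 (Ordinal m0).
have Vc s : V s c.
  move=> i ki; rewrite mxE/=; case: eqP => // i0; move: ki; rewrite i0 leqn0/=.
  by move=> /eqP k0; have := k2 s; rewrite k0.
have cc : dot c c != 0.
  rewrite /dot (bigD1 (Ordinal m0))//= !mxE eqxx mulr1 big1 ?addr0 ?oner_eq0//.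
  by move=> i i0; rewrite mxE/= (negbTE i0) mul0r.
pose f s y := dot c y - dot c (z0 s).
have df s p : sdiff (f s) p c.
  move=> e e0; exists 1 => // y z _ _; rewrite /f dotB.
  have -> : dot c y - dot c (z0 s) - (dot c z - dot c (z0 s)) - (dot c y - dot c z) = 0 by ring.
  by rewrite normr0 mulr_ge0// ltW.
have /choice[r Hr] : forall s, exists r : R, 0 < r /\ forall y, `|y - z0 s| < r -> W s y.
  move=> s; have [[_ oW] _ _ _ _] := ch s; have [r r0 H] := open_norm_ball oW (Hz0 s).1.
  by exists r.
have [r0 r00 Hr0] := min_pos (fun s => (Hr s).1).
have r02 : 0 < r0 / 2 by rewrite divr_gt0.
have [q [q0 [z [iq iq0 Hz]]]] := @rational_transversal f z0 (fun=> c) _ r02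
  (fun s => (Hz0 s).1) (fun s => df s _) (fun s => subrr _)
  (fun s => ex_intro2 _ _ c (Vc s) cc).
have nondeg s : nondegenerate s (affK s q q0 \o G s) (z s).
  have [_ _ _ _ [u [e [Vu Ve Hue]]]] := Hz s => c' dc'.
  have H := Hue _ _ (df s _) dc'.
  have [c'u|c'u] := eqVneq (dot c' u) 0; last by exists u.
  exists e => //; apply: contra_neq H => c'e; rewrite c'u c'e; ring.
exists (State q q0 z (r0 / 2)); split => //=.
- exact: nondegenerate_neq0 (nondeg s0).
- move=> s; have [Vd zr _ _ _] := Hz s; split.
    by rewrite -[z s](subrK (z0 s)); apply: coord_spaceD => //; exact: (Hz0 s).2.
  move=> y yr; apply: (Hr s).2; rewrite -(subrKA (z s)) (le_lt_trans (ler_normD _ _))//.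
  by have := Hr0 s; lra.
- by move=> s; have [_ _ _ ? _] := Hz s.
Qed.

Lemma halving_small (r : nat -> R) :
  (forall n, 0 <= r n) -> (forall n, r n.+1 <= r n / 2) ->
  forall e, 0 < e -> exists n, r n < e.
Proof.
move=> r_ge0 r2 e e0; have rn n : r n * n.+1%:R <= r 0%N.
  elim: n => [|n IH]; first by rewrite mulr1.
  apply: le_trans IH; have := r2 n; have := r_ge0 n; rewrite -[n.+2%:R]natr1.
  have : 1 <= n.+1%:R :> R by rewrite ler1n.
  nra.
exists (Num.bound (r 0%N / e)); set n := Num.bound _.
have : r 0%N / e < n%:R by apply: archi_boundP; rewrite divr_ge0// ltW.
rewrite ltr_pdivrMr// => H; have := rn n; rewrite -natr1.
have := ler0n R n; nra.
Qed.

Lemma nested_centers (c : nat -> 'rV[R]_m) (r : nat -> R) :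
  (forall n, 0 <= r n) -> (forall n, r n.+1 <= r n / 2) ->
  (forall n y, `|y - c n.+1| <= r n.+1 -> `|y - c n| <= r n) ->
  exists l, forall n, `|l - c n| <= r n.
Proof.
move=> r_ge0 r2 nest.
have cc n j : `|c (n + j)%N - c n| <= r n.
  have : `|c (n + j)%N - c (n + j)%N| <= r (n + j)%N by rewrite subrr normr0.
  elim: j {1 3}(c (n + j)%N) => [|j IH] y; first by rewrite addn0.
  by rewrite addnS => /nest/IH.
have cvgc : cvgn c.
  apply/cauchy_cvgP/cauchy_exP => e e0; have [n rne] := halving_small r_ge0 r2 e0.
  exists (c n); exists n => // j /= nj; rewrite -ball_normE/= distrC -(subnKC nj).
  exact: le_lt_trans rne.
exists (limn c) => n; rewrite leNgt; apply/negP => H.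
move: (H); rewrite -subr_gt0 => e0.
move/cvgrPdist_lt : cvgc => /(_ _ e0)[N _ /(_ (n + N)%N (leq_addl _ _))/= HN].
have := ler_normD (limn c - c (n + N)%N) (c (n + N)%N - c n); rewrite subrKA.
by have := cc n N; lra.
Qed.

Definition approximable (x : 'M[R]_(d, m)) (n : nat) :=
  \forall Q \near +oo, exists q q0, [/\ in_OKm q, in_OK q0, q != 0,
    `|dotKS sigma q x + diagK sigma q0| < Q ^- n & `|diagKm sigma q| <= Q].

Lemma exists_approximable (xi : nat -> 'M[R]_(d, m)) :
  (forall s, exists z, W s z /\ V s z) ->
  exists x, [/\ prodS M x, totally_irrational sigma x, forall n, approximable x n &
    forall n, totally_irrational sigma (xi n) -> x <> xi n].
Proof.
move=> /good_exists[st0 gst0]; have [eK HeK] := fieldExt_rat_surj K.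
(* Enumerates all pairs (q, q0) through vectors of natural numbers, K being countable; undecodable
   codes give (0, 0). *)
pose e (n : nat) : 'rV[K]_m * K :=
  oapp (fun v : 'rV[nat]_m * nat => (map_mx eK v.1, eK v.2)) (0, 0) (choice.unpickle n).
have e_surj p p0 : exists n, e n = (p, p0).
  have /choice[v Hv] : forall i, exists j, eK j = p 0 i by move=> i; exact: HeK.
  have [v0 Hv0] := HeK p0.
  exists (choice.pickle (\row_i v i, v0)); rewrite /e choice.pickleK/= Hv0.
  by congr pair; apply/rowP => i; rewrite !mxE.
have /choice[f Hf] : forall a : nat * {st | good st}, exists st' : {st | good st},
    refines a.1 (e a.1).1 (e a.1).2 (xi a.1) (sval a.2) (sval st').
  move=> [n [st gst]]; have [st' [gst' H]] := refines_exists n (e n).1 (e n).2 (xi n) gst.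
  by exists (exist _ st' gst').
pose S := nat_rect (fun=> {st | good st}) (exist _ st0 gst0) (fun n st => f (n, st)).
pose st n := sval (S n).
have gst n : good (st n) by exact: svalP.
have nst n : refines n (e n).1 (e n).2 (xi n) (st n) (st n.+1) by exact: (Hf (n, S n)).
have /choice[l Hl] : forall s, exists l, forall n, `|l - st_center (st n) s| <= st_radius (st n).
  move=> s; apply: nested_centers.
  - by move=> n; have [_ _ /ltW] := gst n.
  - by move=> n; have [] := nst n.
  - by move=> n y yr; have [_ _ /(_ s y yr)[]] := nst n.
have Wl s : W s (l s) by have [_ _ _ /(_ s)[_ +] _] := gst 0%N; apply.
have Vl s : V s (l s).
  (* The centres lie in the coordinate subspace and the radii tend to 0. *)
  move=> i ki; apply/eqP; rewrite -normr_eq0 eq_le normr_ge0 andbT leNgt; apply/negP => l0.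
  have [n rn] : exists n, st_radius (st n) < `|l s 0 i|.
    apply: (@halving_small (fun n => st_radius (st n))); last exact: l0.
      by move=> n; have [_ _ /ltW] := gst n.
    by move=> n; have [] := nst n.
  have [_ _ _ /(_ s)[Vc _] _] := gst n.
  have := mx_coord_norm_le (l s - st_center (st n) s) 0 i.
  rewrite !mxE (Vc i ki) subr0 => H; have := Hl s n; lra.
pose x : 'M[R]_(d, m) := \matrix_(s, i) G s (l s) 0 i.
have rowx s : row s x = G s (l s) by apply/rowP => i; rewrite !mxE.
have affx s q q0 : (dotKS sigma q x + diagK sigma q0) s 0 = affK s q q0 (G s (l s)).
  rewrite !mxE /affK /aff; congr (_ + _); apply: eq_bigr => i _; by rewrite mxE.
exists x; split.
- by move=> s; rewrite rowx; exact: (chart_mem (ch s) (Wl s) (Vl s)).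
- move=> q q0 _ _ q_neq0; exists s0; have [n en] := e_surj q q0.
  have [_ _ /(_ s0 (l s0) (Hl s0 n.+1))[_ _ + _]] := nst n.
  by rewrite en /= => /(_ q_neq0 erefl); rewrite -affx !mxE.
- move=> n; pose h i := height (st_q (st i)).
  near=> Q.
  have Q1 : 1 <= Q by near: Q; apply: nbhs_pinfty_ge; exact: num_real.
  have Qh : h n <= Q by near: Q; apply: nbhs_pinfty_ge; exact: num_real.
  (* As h_n <= Q, the least index from n on whose height exceeds Q is i+1 with i >= n. Then h_i <=
     Q, and |f| at stage i is below (1 + h_{i+1})^-i <= Q^-n. *)
  have exi : exists i, (n <= i)%N && (Q < h i).
    exists (maxn n (Num.bound Q)).+1; rewrite (leq_trans (leq_maxl n (Num.bound Q)) (leqnSn _))/=.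
    have [_ H _] := nst (maxn n (Num.bound Q)); apply: lt_le_trans H.
    have /lt_le_trans -> // : Q < (Num.bound Q)%:R by apply: archi_boundP; lra.
    by rewrite ler_nat leq_maxr.
  case: (ex_minnP exi) => -[|i] /andP[ni Qi] mini.
    by move: ni Qh; rewrite leqn0 => /eqP ->; rewrite leNgt Qi.
  have [in'|{}ni] : i.+1 = n \/ (n <= i)%N.
    by move: ni; rewrite leq_eqVlt => /orP[/eqP ->|]; [left|right].
    by move: Qh; rewrite -in' leNgt Qi.
  have hi : h i <= Q.
    rewrite leNgt; apply/negP => Qhi; have := mini i; rewrite ni Qhi => /(_ isT).
    by rewrite ltnn.
  have [[iq iq0] q_neq0 _ _ _] := gst i.
  exists (st_q (st i)), (st_q0 (st i)); split => //.
  have Q0 : 0 < Q by lra.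
  apply: mx_norm_lt; first by rewrite invr_gt0 exprn_gt0.
  move=> s j; rewrite (ord1 j) affx.
  have [_ _ /(_ s (l s) (Hl s i.+1))[_ + _ _]] := nst i.
  move=> /lt_le_trans; apply; rewrite lef_pV2 ?posrE ?exprn_gt0//; last first.
    by move: Qi; rewrite /h; lra.
  have Qh1 : Q <= 1 + h i.+1 by lra.
  apply: (@le_trans _ _ ((1 + h i.+1) ^+ n)); first by rewrite lerXn2r ?nnegrE//; lra.
  by apply: ler_weXn2l => //; lra.
- move=> n tx xE.
  have [_ _ /(_ s0 (l s0) (Hl s0 n.+1))[_ _ _ /(_ tx)[s1 /(_ (l s1) (Hl s1 n.+1))]]] := nst n.
  by rewrite -rowx xE eqxx.
Unshelve. all: by end_near. Qed.

End RationalHyperplanes.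

(** * From approximability to singularity and infinite exponent *)

Section UniformApproximation.
Variables (R : realType) (K : fieldExtType rat) (d m : nat).
Variables (sigma : 'I_d -> {rmorphism K -> R}) (x : 'M[R]_(d, m)).
Hypothesis app : forall n, approximable sigma x n.

(** Exponent m+1 suffices: Q^-(m+1) <= c Q^-m once Q >= 1/c. *)
Lemma approximable_singular : singular sigma x.
Proof.
move=> c c0; have H := app m.+1; near=> Q.
have Q0 : 0 < Q by near: Q; apply: nbhs_pinfty_gt; exact: num_real.
have Qc : c^-1 <= Q by near: Q; apply: nbhs_pinfty_ge; exact: num_real.
have [q [q0 [iq iq0 q_neq0 h1 h2]]] : exists q q0, [/\ in_OKm q, in_OK q0, q != 0,
    `|dotKS sigma q x + diagK sigma q0| < Q ^- m.+1 & `|diagKm sigma q| <= Q].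
  by near: Q.
exists q, q0; split => //; apply: (lt_le_trans h1).
rewrite exprS invfM ler_pM2r ?invr_gt0 ?exprn_gt0//.
by rewrite -[c]invrK lef_pV2 ?posrE// invr_gt0.
Unshelve. all: by end_near. Qed.

Lemma approximable_uniform_exponent : uniform_exponent sigma x = +oo%E.
Proof.
apply/eqyP => A A0; pose n := Num.bound A.
apply: (@le_trans _ _ (n%:R)%:E); first by rewrite lee_fin ltW// archi_boundP// ltW.
apply: ereal_sup_ubound; exists n%:R => //=; have H := app n; near=> Q.
have Q0 : 0 < Q by near: Q; apply: nbhs_pinfty_gt; exact: num_real.
have [q [q0 [iq iq0 q_neq0 h1 h2]]] : exists q q0, [/\ in_OKm q, in_OK q0, q != 0,
    `|dotKS sigma q x + diagK sigma q0| < Q ^- n & `|diagKm sigma q| <= Q].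
  by near: Q.
exists q0, q; split => //.
  by apply: contra_neq q_neq0 => -[_].
by rewrite powRN powR_mulrn// ltW.
Unshelve. all: by end_near. Qed.

End UniformApproximation.

Theorem theorem2p8 (R : realType) (K : fieldExtType rat) (d : nat)
    (hd : \dim {:K} = d)
    (hK : totally_real R K)
    (sigma : 'I_d -> {rmorphism K -> R})
    (hsigma : enumerates_embeddings sigma)
    (m : nat) (M : 'I_d -> set 'rV[R]_m) (k : 'I_d -> nat)
    (hM : forall s, analytic_submanifold (k s) (M s))
    (hconn : connected (prodS M))
    (hk : forall s, (2 <= k s)%N)
    (hhyp : forall s (H : set 'rV[R]_m),
       affine_K_hyperplane sigma s H -> ~ (M s `<=` H)) :
  ~ countable [set x : 'M[R]_(d, m) |
      [/\ prodS M x, totally_irrational sigma x, singular sigma x &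
          uniform_exponent sigma x = +oo%E]].
Proof.
have d0 : (0 < d)%N.
  rewrite -hd lt0n dimv_eq0; apply/eqP => K0.
  by have := memvf (1 : K); rewrite K0 memv0 oner_eq0.
pose s0 : 'I_d := Ordinal d0; have sigma_inj := hsigma.1.
have km s : (k s <= m)%N by have [] := hM s.
have m0 : (0 < m)%N by rewrite (leq_trans _ (km s0))// (leq_trans _ (hk s0)).
have off_hyperplane s p p0 : p != 0 -> exists2 y, M s y & affK sigma s p p0 y != 0.
  move=> p_neq0; apply: contrapT => N.
  apply: (hhyp s [set y | \sum_(j < m) sigma s (p 0 j) * y 0 j + sigma s p0 = 0]).
    by exists p, p0.
  by move=> y My; apply/eqP; apply: contrapT => H; apply: N; exists y => //; exact/negP.
(* An empty factor would lie in every hyperplane, and m > 0 provides one. *)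
have M_ne s : M s !=set0.
  have [|y My _] := @off_hyperplane s (delta_mx 0 (Ordinal m0)) 0; last by exists y.
  by apply/eqP => /rowP/(_ (Ordinal m0)); rewrite !mxE !eqxx => /eqP; rewrite oner_eq0.
have /choice[p Mp] := M_ne.
have /choice[U /choice[W /choice[F /choice[G HG]]]] :
    forall s, exists U W F G, chart (k s) (M s) U W F G /\ U (p s).
  by move=> s; exact: submanifold_chart (hM s) (Mp s).
have ch s := (HG s).1.
have base s : exists z, W s z /\ coord_space (k s) z.
  have [_ _ FK _ MV] := ch s; exists (F s (p s)).
  by split; [exact: (FK _ (HG s).2).1|apply/(MV _ (HG s).2)].
have cM0 := connected_prodS_component (s := s0) hconn M_ne.
(* An injection [i] of X into the naturals is inverted to a sequence [xi] listing X, with value 0 at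
   numbers not attained. The construction run against [xi] gives x in X different from [xi (i x)],
   that is, from itself. *)
set X := [set x | _] => /countable_injP[i i_inj].
have /choice[xi Hxi] : forall n : nat, exists x : 'M[R]_(d, m), (exists2 y, X y & i y = n) -> X x /\ i x = n.
  move=> n; have [[y Xy yn]|] := pselect (exists2 y, X y & i y = n); first by exists y.
  by exists 0.
have [x [Mx tx ax xxi]] := exists_approximable sigma_inj hk km ch (hM s0) cM0
  (off_hyperplane s0) xi base.
have Xx : X x.
  by split => //; [exact: approximable_singular|exact: approximable_uniform_exponent].
have [Xxi ixi] := Hxi (i x) (ex_intro2 _ _ x Xx erefl).
apply: (xxi (i x)); first by case: Xxi.
by apply: i_inj; rewrite ?inE// ixi.
Qed.
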